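(* Let $\gamma>1$, and let the constants $\omega_0,\omega_1,\omega_2,\omega_3$ be given in terms of the spatially constant reference state by $$\omega_0=\frac{-1}{\gamma-1},\qquad \omega_1=-\Delta t\,u_R\frac{5+\gamma}{2(\gamma-1)},$$ $$\omega_2=\frac{\Delta t^2}{\rho_R}\Big(\frac{-\gamma-5}{\gamma-1}E_R+\frac{\gamma^2+5}{(\gamma-1)^2}p_R\Big),\qquad \omega_3=\frac{\Delta t^3u_R}{\rho_R}\Big(\frac{-2}{\gamma-1}E_R+\frac{\gamma^2-\gamma+2}{(\gamma-1)^2}p_R\Big).$$ Let $p_L^*\in H^\infty$ be a ($\varepsilon$-dependent) function possessing a Hilbert expansion, and let $p_L\in H^\infty$ fulfil, on $\Omega=[-\pi,\pi]$ with periodic boundary conditions, $$\omega_0p_L+\omega_1\partial_xp_L+\frac{\omega_2}{\varepsilon^2}\partial_{xx}p_L+\frac{\omega_3}{\varepsilon^2}\partial_{xxx}p_L=p_L^*.$$ Then $p_L$ has a Hilbert expansion; in particular $$p_L=\mathrm{const}+\mathcal O(\varepsilon^2),$$ where $\mathrm{const}$ is constant in space.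
   Context: $\varepsilon\in(0,\varepsilon_0]$ is a small parameter, $\Delta t>0$ is fixed independent of $\varepsilon$. $H^\infty=\{\varphi\in L^2(\Omega):\sum_{k\in\mathbb Z}(1+|k|^2)^p|\widehat\varphi(k)|^2<\infty\ \forall p\in\mathbb N\}$, where $\widehat\varphi(k)$ are the Fourier coefficients of the $2\pi$-periodic function $\varphi$. The reference state $(\rho_R,\rho_Ru_R,E_R)$ is constant in space, with $\rho_R>0$ and pressure $p_R>0$ linked by the equation of state $E_R=\frac{p_R}{\gamma-1}+\frac{\varepsilon^2}{2}\rho_Ru_R^2$; its components may depend on $\varepsilon$, in which case they have Hilbert expansions with $\rho_{R,(0)}>0$, $p_{R,(0)}>0$. A family $\varphi(\cdot;\varepsilon)\in H^\infty$ has a Hilbert expansion if there are $\varphi_{(j)}\in H^\infty$ independent of $\varepsilon$ with $\varphi=\varphi_{(0)}+\varepsilon\varphi_{(1)}+\varepsilon^2\varphi_{(2)}+\dots$ as $\varepsilon\to0$, i.e. for every $N$ the remainder after the term $\varepsilon^N\varphi_{(N)}$ is $\mathcal O(\varepsilon^{N+1})$ in every Sobolev norm. *)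

(* Defs.v *)
From HB Require Import structures.
From mathcomp Require Import all_boot all_order all_algebra.
From mathcomp Require Import complex.
From mathcomp Require Import all_classical all_reals all_analysis.
Set Implicit Arguments.
Unset Strict Implicit.
Unset Printing Implicit Defensive.
Import Order.TTheory GRing.Theory Num.Theory numFieldNormedType.Exports.
Local Open Scope classical_set_scope.
Local Open Scope ring_scope.

Section PeriodicFunctions.
Context {R : realType}.
Local Notation mu := (@lebesgue_measure R).

Definition Omega : set R := `[- pi, pi]%classic.

(* L^2(Omega); a function on Omega is represented by its 2pi-periodic
   extension to R, and nothing below depends on its values on null sets. *)
Definition L2per (f : R -> R) : Prop :=
  [/\ periodic f (pi *+ 2), measurable_fun setT f &
      mu.-integrable Omega (fun x => (f x ^+ 2)%:E)].

(* (1 / 2pi) \int_Omega f(x) e^{-ikx} dx *)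
Definition fourier (f : R -> R) (k : int) : R[i] :=
  Complex ((pi *+ 2)^-1 * \int[mu]_(x in Omega) (f x * cos (k%:~R * x)))
          (- ((pi *+ 2)^-1 * \int[mu]_(x in Omega) (f x * sin (k%:~R * x)))).

Definition sobolev_sqnorm (p : nat) (f : R -> R) : \bar R :=
  \esum_(k in [set: int])
    ((1 + `|k%:~R| ^+ 2) ^+ p * ComplexField.Normc.normc (fourier f k) ^+ 2)%:E.

Definition sobolev_norm (p : nat) (f : R -> R) : \bar R :=
  poweR (sobolev_sqnorm p f) 2^-1.

Definition Hinfty (f : R -> R) : Prop :=
  L2per f /\ forall p : nat, (sobolev_sqnorm p f < +oo)%E.

Definition test_function (v : R -> R) : Prop :=
  periodic v (pi *+ 2) /\ forall n x, derivable (derive1n n v) x 1.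

(* Elements of H^infty are only determined almost everywhere, so derivatives
   are taken in the weak sense, against smooth 2pi-periodic functions (hence
   without boundary terms). For smooth f this is the classical derivative. *)
Definition weak_derivative (n : nat) (f g : R -> R) : Prop :=
  L2per g /\ forall v, test_function v ->
    \int[mu]_(x in Omega) (g x * v x) =
    (-1) ^+ n * \int[mu]_(x in Omega) (f x * derive1n n v x).

Definition periodic_ode3 (a0 a1 a2 a3 : R) (f g : R -> R) : Prop :=
  exists f1 f2 f3 : R -> R,
    [/\ weak_derivative 1 f f1, weak_derivative 2 f f2,
        weak_derivative 3 f f3 &
        {ae mu, forall x, Omega x ->
          a0 * f x + a1 * f1 x + a2 * f2 x + a3 * f3 x = g x}].

End PeriodicFunctions.

Section HilbertExpansions.
Context {R : realType}.

(* g(eps) = O(eps^n) as eps -> 0, for a family of (extended) norms g *)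
Definition bigO_eps (n : nat) (g : R -> \bar R) : Prop :=
  exists C : R, \forall eps \near 0^'+, (g eps <= (C * eps ^+ n)%:E)%E.

Definition scalar_expansion (a : R -> R) (c : nat -> R) : Prop :=
  forall N : nat,
    bigO_eps N.+1 (fun eps => `|a eps - \sum_(j < N.+1) eps ^+ j * c j|%:E).

Definition hilbert_expansion (phi : R -> R -> R) (c : nat -> R -> R) : Prop :=
  (forall j, Hinfty (c j)) /\
  forall N p : nat,
    bigO_eps N.+1 (fun eps =>
      sobolev_norm p (fun x => phi eps x - \sum_(j < N.+1) eps ^+ j * c j x)).

Definition has_hilbert_expansion (phi : R -> R -> R) : Prop :=
  exists c : nat -> R -> R, hilbert_expansion phi c.

Definition constant_up_to (n : nat) (phi : R -> R -> R) : Prop :=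
  exists c : R -> R, forall p : nat,
    bigO_eps n (fun eps => sobolev_norm p (fun x => phi eps x - c eps)).

End HilbertExpansions.

Section Coefficients.
Context {R : realType}.
Implicit Types gamma dt rho u E p : R.

Definition omega0 gamma : R := - 1 / (gamma - 1).

Definition omega1 gamma dt u : R :=
  - dt * u * ((5 + gamma) / (2 * (gamma - 1))).

Definition omega2 gamma dt rho E p : R :=
  dt ^+ 2 / rho *
  ((- gamma - 5) / (gamma - 1) * E +
   (gamma ^+ 2 + 5) / (gamma - 1) ^+ 2 * p).

Definition omega3 gamma dt rho u E p : R :=
  dt ^+ 3 * u / rho *
  (- 2 / (gamma - 1) * E +
   (gamma ^+ 2 - gamma + 2) / (gamma - 1) ^+ 2 * p).

End Coefficients.

(* Main.v *)
Require Import Defs.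
From HB Require Import structures.
From mathcomp Require Import all_boot all_order all_algebra.
From mathcomp Require Import complex.
From mathcomp Require Import all_classical all_reals all_analysis.
From mathcomp Require Import measurable_realfun.
From mathcomp Require Import ring lra zify.
Set Implicit Arguments.
Unset Strict Implicit.
Unset Printing Implicit Defensive.
Import Order.TTheory GRing.Theory Num.Theory numFieldNormedType.Exports.
Local Open Scope classical_set_scope.
Local Open Scope complex_scope.
Local Open Scope ring_scope.

(** On the Fourier side the equation decouples into one scalar equation per wave
    number [k]. With [w0], [w1], [w2], [w3] the four constants of the equation,
    the Fourier coefficients [A] of the right-hand side and [B] of the solution
    satisfy [D B = eps^2 A], where
      [D = eps^2 w0 + eps^2 w1 (ik) + w2 (ik)^2 + w3 (ik)^3].
    The constant [w0] is negative, and by the equation of state [w2] stays above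
    a positive constant as eps tends to 0 ([omega2_bounded_below]): its leading
    part is a positive multiple of the pressure. The real part
    [eps^2 w0 - k^2 w2] of [D] is therefore bounded away from 0, uniformly in
    small eps and in [k != 0]. Hence [B = eps^2 A / D], and all modes but
    [k = 0] are of order [eps^2], which is the second claim
    ([dispersion_solution_oscillation], [oscillation_constant_up_to]).
    For [k = 0] the equation reads [w0 B = A].

    For the first claim, [D] is a polynomial in [ik] whose coefficients expand in
    powers of eps, so [D^-1] has an expansion too. Its coefficients grow at most
    polynomially in [k], and the rapid decay of [A] absorbs such growth
    ([dispersion_solution_expandable]). Instead of computing with power series,
    expandability is characterised as the largest property stable under writing
    a family as a leading coefficient plus eps times another member
    ([expandable_coind]); products and inverses then both follow from a single
    closure argument ([expandable_affine]).

    Two facts connect this calculus with functions. Sobolev norms are weighted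
    square sums of Fourier coefficients, so bounds in all of them amount to
    pointwise bounds against all powers of the weight
    ([sobolev_coefficient_le], [sobolev_norm_le]). And every rapidly decaying
    sequence with the symmetry of a real function is the sequence of Fourier
    coefficients of an element of [Hinfty] ([fourier_reconstruction]), which
    supplies the functions in the expansion of the solution. *)

(** * Families of Fourier coefficients and their expansions in eps *)

Section SymbolCalculus.
Context {R : realType}.
Local Notation nrm := (@ComplexField.Normc.normc R).
Implicit Types (a b f h u v : R -> int -> R[i]) (c : int -> R[i]).
Implicit Types K : (R -> int -> R[i]) -> Prop.

Lemma normc_ge0 (z : R[i]) : 0 <= nrm z.
Proof. by case: z => x y; exact: sqrtr_ge0. Qed.

Lemma ler_normcD (z t : R[i]) : nrm (z + t) <= nrm z + nrm t.
Proof. exact: (@le_normcD R). Qed.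

Lemma normc_conj (z : R[i]) : nrm z^*%C = nrm z.
Proof. by case: z => x y /=; rewrite sqrrN. Qed.

Lemma normc_real (x : R) : nrm x%:C = `|x|.
Proof. by rewrite /= expr0n addr0 sqrtr_sqr. Qed.

Definition weight (k : int) : R := 1 + `|k%:~R| ^+ 2.

Lemma weight_ge1 k : 1 <= weight k.
Proof. by rewrite /weight lerDl sqr_ge0. Qed.

Lemma weight_gt0 k : 0 < weight k.
Proof. exact: lt_le_trans (weight_ge1 k). Qed.

Lemma weightX_gt0 k s : 0 < weight k ^+ s.
Proof. by rewrite exprn_gt0 ?weight_gt0. Qed.

(** Symbols: at most polynomial growth in the wave number, uniformly for small
    eps. Differential operators act on Fourier coefficients by such factors. *)
Definition tempered a := exists (C : R) (s : nat),
  \forall eps \near 0^'+, forall k, nrm (a eps k) <= C * weight k ^+ s.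

(** Decay faster than every power of the wave number, uniformly for small eps.
    This is boundedness in every Sobolev norm, stated with suprema instead of
    sums; the loss of a fixed power of the weight in passing from one to the
    other is harmless because all powers are quantified over. *)
Definition rapid a := forall s : nat, exists C : R,
  \forall eps \near 0^'+, forall k, weight k ^+ s * nrm (a eps k) <= C.

(** The Fourier coefficients of a real function have this symmetry. It is
    carried along so that the coefficients of an expansion, which are found on
    the Fourier side, are again those of real functions. *)
Definition conj_symmetric a :=
  \forall eps \near 0^'+, forall k, a eps (- k) = (a eps k)^*%C.

Definition symbol a := tempered a /\ conj_symmetric a.

Definition rapid_symbol a := rapid a /\ conj_symmetric a.

Definition near_eq a b :=
  \forall eps \near 0^'+, forall k, a eps k = b eps k.

(** What the expansion calculus uses of a class of bounded families. The two
    instances, symbols and rapidly decaying symbols, allow one proof of each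
    closure property to serve for the operators and for the functions they act
    on. *)
Record symbol_module K : Prop := SymbolModule {
  sm_ext : forall a b, near_eq a b -> K a -> K b;
  sm_add : forall a b, K a -> K b -> K (fun eps k => a eps k + b eps k);
  sm_mul : forall v a, symbol v -> K a -> K (fun eps k => v eps k * a eps k);
}.

Lemma conj_symmetric_ext a b : near_eq a b -> conj_symmetric a -> conj_symmetric b.
Proof.
move=> ab ha; near=> eps => k.
have e : forall k, a eps k = b eps k by near: eps; exact: ab.
by rewrite -!e; move: k; near: eps.
Unshelve. all: by end_near. Qed.

Lemma conj_symmetricD a b : conj_symmetric a -> conj_symmetric b ->
  conj_symmetric (fun eps k => a eps k + b eps k).
Proof.
by move=> ha hb; near=> eps => k; rewrite rmorphD/=; congr (_ + _);
  move: k; near: eps.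
Unshelve. all: by end_near. Qed.

Lemma conj_symmetricM a b : conj_symmetric a -> conj_symmetric b ->
  conj_symmetric (fun eps k => a eps k * b eps k).
Proof.
by move=> ha hb; near=> eps => k; rewrite rmorphM/=; congr (_ * _);
  move: k; near: eps.
Unshelve. all: by end_near. Qed.

Lemma symbol_moduleS : symbol_module symbol.
Proof.
split.
- move=> a b ab [[C [s Cs]] ha]; split; last exact: conj_symmetric_ext ab ha.
  exists C, s; near=> eps => k.
  have <- : a eps k = b eps k by move: k; near: eps.
  by move: k; near: eps.
- move=> a b [[C [s Cs]] ha] [[D [t Dt]] hb]; split; last exact: conj_symmetricD.
  exists (`|C| + `|D|), (s + t)%N; near=> eps => k.
  apply: (le_trans (ler_normcD _ _)); rewrite mulrDl.
  have w1 n m : weight k ^+ n <= weight k ^+ (n + m).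
    by rewrite ler_weXn2l ?weight_ge1 // leq_addr.
  apply: lerD.
    apply: (@le_trans _ _ (C * weight k ^+ s)); first by move: k {w1}; near: eps.
    apply: (@le_trans _ _ (`|C| * weight k ^+ s)).
      by rewrite ler_wpM2r ?ler_norm// ltW// weightX_gt0.
    by rewrite ler_wpM2l.
  apply: (@le_trans _ _ (D * weight k ^+ t)); first by move: k {w1}; near: eps.
  apply: (@le_trans _ _ (`|D| * weight k ^+ t)).
    by rewrite ler_wpM2r ?ler_norm// ltW// weightX_gt0.
  by rewrite ler_wpM2l// addnC.
- move=> a b [[C [s Cs]] ha] [[D [t Dt]] hb]; split; last exact: conj_symmetricM.
  exists (C * D), (s + t)%N; near=> eps => k.
  rewrite ComplexField.Normc.normcM exprD mulrACA.
  by apply: ler_pM; rewrite ?normc_ge0//; move: k; near: eps.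
Unshelve. all: by end_near. Qed.

(** A polynomially growing factor costs a fixed power of the weight, which a
    rapidly decaying family can afford. *)
Lemma symbol_moduleR : symbol_module rapid_symbol.
Proof.
split.
- move=> a b ab [ra ha]; split; last exact: conj_symmetric_ext ab ha.
  move=> s; have [C Cs] := ra s; exists C; near=> eps => k.
  have <- : a eps k = b eps k by move: k; near: eps.
  by move: k; near: eps.
- move=> a b [ra ha] [rb hb]; split; last exact: conj_symmetricD.
  move=> s; have [C Cs] := ra s; have [D Ds] := rb s.
  exists (C + D); near=> eps => k.
  apply: (@le_trans _ _ (weight k ^+ s * (nrm (a eps k) + nrm (b eps k)))).
    by rewrite ler_pM2l ?weightX_gt0// ler_normcD.
  by rewrite mulrDr; apply: lerD; move: k; near: eps.
- move=> a b [[C [s Cs]] ha] [rb hb]; split; last exact: conj_symmetricM.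
  move=> t; have [D Ds] := rb (s + t)%N.
  exists (`|C| * D); near=> eps => k.
  rewrite ComplexField.Normc.normcM.
  have h : nrm (a eps k) <= `|C| * weight k ^+ s.
    apply: (@le_trans _ _ (C * weight k ^+ s)); first by move: k; near: eps.
    by rewrite ler_wpM2r ?ler_norm// ltW// weightX_gt0.
  have h2 : weight k ^+ (s + t) * nrm (b eps k) <= D by move: k {h}; near: eps.
  apply: (@le_trans _ _ (`|C| * (weight k ^+ (s + t) * nrm (b eps k)))); last first.
    by rewrite ler_wpM2l.
  set w := weight k ^+ t; set x := nrm (a eps k); set y := nrm (b eps k).
  have -> : w * (x * y) = x * (w * y) by ring.
  rewrite exprD -/w; have -> : `|C| * (weight k ^+ s * w * y) =
    (`|C| * weight k ^+ s) * (w * y) by ring.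
  by apply: ler_wpM2r => //; rewrite mulr_ge0 ?normc_ge0// ltW// weightX_gt0.
Unshelve. all: by end_near. Qed.

Lemma near_neq0 : \forall eps \near (0 : R)^'+, eps != 0.
Proof. by near=> eps; rewrite gt_eqF//; near: eps; exact: nbhs_right_gt.
Unshelve. all: by end_near. Qed.

(** The remainder of order [N], divided by [eps ^+ N]: it is bounded exactly
    when the truncated expansion is accurate to order [eps ^+ N]. *)
Definition remainder a (c : nat -> int -> R[i]) N eps k : R[i] :=
  (a eps k - \sum_(j < N) (eps ^+ j)%:C * c j k) / (eps ^+ N)%:C.

Definition expandable K a := exists c : nat -> int -> R[i], forall N, K (remainder a c N).

Lemma symbol_fixed_bound c (C : R) (s : nat) :
  (forall k, nrm (c k) <= C * weight k ^+ s) ->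
  (forall k, c (- k) = (c k)^*%C) -> symbol (fun _ => c).
Proof.
by move=> cC hc; split; [exists C, s|]; near=> eps => k.
Unshelve. all: by end_near. Qed.

Lemma symbol_scalar (g : R -> R) (C : R) :
  (\forall eps \near 0^'+, `|g eps| <= C) -> symbol (fun eps _ => (g eps)%:C).
Proof.
move=> gC; split; last by near=> eps => k; rewrite conjc_real.
exists C, 0%N; near=> eps => k; rewrite normc_real expr0 mulr1.
by near: eps.
Unshelve. all: by end_near. Qed.

Lemma symbol_eps (x : R) : symbol (fun eps _ => (x * eps)%:C).
Proof.
apply: (@symbol_scalar _ (`|x|)); near=> eps.
rewrite normrM -{2}[`|x|]mulr1 ler_wpM2l// ger0_norm.
  by near: eps; exact: nbhs_right_le.
by near: eps; exact: nbhs_right_ge.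
Unshelve. all: by end_near. Qed.

Lemma expandable_bounded K a : symbol_module K -> expandable K a -> K a.
Proof.
move=> HK [c /(_ 0%N)]; apply: (sm_ext HK); near=> eps => k.
by rewrite /remainder big_ord0 subr0 expr0 divr1.
Unshelve. all: by end_near. Qed.

(** Splitting off the leading coefficient leaves a family that is again
    expandable: its coefficients are the shifted ones. *)
Lemma expandable_step K a : symbol_module K -> expandable K a ->
  exists c a', [/\ K (fun _ => c), expandable K a' &
    near_eq a (fun eps k => c k + eps%:C * a' eps k)].
Proof.
move=> HK ea; have Ka := expandable_bounded HK ea.
case: ea => c Kc; exists (c 0%N), (remainder a c 1).
have e : near_eq a (fun eps k => c 0%N k + eps%:C * remainder a c 1 eps k).
  near=> eps => k; rewrite /remainder big_ord1 expr0 expr1 mul1r.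
  have e0 : eps%:C != 0 :> R[i].
    by rewrite fmorph_eq0; near: eps; exact: near_neq0.
  by field.
split=> //.
- apply: (sm_ext HK) (sm_add HK Ka (sm_mul HK (symbol_eps (-1)) (Kc 1%N))).
  near=> eps => k.
  have -> : a eps k = c 0%N k + eps%:C * remainder a c 1 eps k.
    by move: k; near: eps; exact: e.
  by rewrite mulN1r rmorphN/=; ring.
- exists (fun j => c j.+1) => N; apply: (sm_ext HK) (Kc N.+1).
  near=> eps => k; rewrite /remainder big_ord1 expr0 expr1 mul1r.
  have e0 : eps%:C != 0 :> R[i].
    by rewrite fmorph_eq0; near: eps; exact: near_neq0.
  rewrite big_ord_recl expr0 mul1r exprS rmorphM/= invfM mulrA.
  congr (_ / _); rewrite [in RHS]mulrC opprD addrA mulrBl mulrC; congr (_ - _).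
  rewrite mulr_suml; apply: eq_bigr => j _.
  by rewrite /bump/= add1n exprS rmorphM/=; field.
Unshelve. all: by end_near. Qed.

(** Conversely, expandability is the largest property that is stable under
    splitting off a leading coefficient. An expansion of unbounded length is
    thus obtained by exhibiting a class of bounded families closed under one
    division step, without ever writing its coefficients or their
    recursion. *)
Lemma expandable_coind K (G : (R -> int -> R[i]) -> Prop) :
  symbol_module K ->
  (forall a, G a -> K a /\ exists c a',
     G a' /\ near_eq a (fun eps k => c k + eps%:C * a' eps k)) ->
  forall a, G a -> expandable K a.
Proof.
move=> HK HG a0 Ga0.
have step (a : R -> int -> R[i]) : exists p : (int -> R[i]) * (R -> int -> R[i]),
    G a -> G p.2 /\ near_eq a (fun eps k => p.1 k + eps%:C * p.2 eps k).
  have [Ga|nGa] := pselect (G a); last by exists (fun=> 0, a).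
  by have [_ [c [a' h]]] := HG _ Ga; exists (c, a').
have [f Hf] := choice step.
(* [s n] is the remainder left after n division steps. *)
pose s n := iter n (fun a => (f a).2) a0; pose c n := (f (s n)).1.
have Gs n : G (s n) by elim: n => //= n IH; have [] := Hf _ IH.
have Es N : near_eq a0 (fun eps k =>
    \sum_(j < N) (eps ^+ j)%:C * c j k + (eps ^+ N)%:C * s N eps k).
  elim: N => [|N IH]; near=> eps => k; first by rewrite big_ord0 add0r expr0 mul1r.
  have -> : a0 eps k = \sum_(j < N) (eps ^+ j)%:C * c j k +
     (eps ^+ N)%:C * s N eps k by move: k; near: eps.
  have -> : s N eps k = c N k + eps%:C * s N.+1 eps k.
    by move: k; near: eps; have [] := Hf _ (Gs N).
  by rewrite big_ord_recr/= exprSr rmorphM/=; ring.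
exists c => N; have [KsN _] := HG _ (Gs N); apply: (sm_ext HK) KsN.
near=> eps => k; rewrite /remainder.
have -> : a0 eps k = \sum_(j < N) (eps ^+ j)%:C * c j k +
   (eps ^+ N)%:C * s N eps k by move: k; near: eps; exact: Es.
have e0 : (eps ^+ N)%:C != 0 :> R[i].
  by rewrite fmorph_eq0 expf_neq0//; near: eps; exact: near_neq0.
by rewrite addrC addKr mulrC mulKf.
Unshelve. all: by end_near. Qed.

End SymbolCalculus.

(** * Closure properties of expandable families *)

Section ExpansionCalculus.
Context {R : realType}.
Local Notation nrm := (@ComplexField.Normc.normc R).
Implicit Types (a b f h u v : R -> int -> R[i]) (c : int -> R[i]).
Implicit Types K : (R -> int -> R[i]) -> Prop.

Lemma expandable_ext K a b : symbol_module K ->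
  near_eq a b -> expandable K a -> expandable K b.
Proof.
move=> HK ab [c Hc]; exists c => N; apply: (sm_ext HK) (Hc N).
near=> eps => k; rewrite /remainder.
by have -> : a eps k = b eps k by move: k; near: eps.
Unshelve. all: by end_near. Qed.

Lemma expandable_fixed K c : symbol_module K ->
  K (fun _ => c) -> expandable K (fun _ => c).
Proof.
move=> HK Kc; apply: (expandable_coind (G := fun a =>
  exists2 c : int -> R[i], a = (fun _ => c) & K a)) => //.
- move=> _ [d -> Kd]; split=> //; exists d, (fun=> fun=> 0); split.
    exists (fun=> 0) => //.
    apply: (sm_ext HK) (sm_mul HK (symbol_eps 0) Kd).
    by near=> eps => k; rewrite !mul0r.
  by near=> eps => k; rewrite mulr0 addr0.
- by exists c.
Unshelve. all: by end_near. Qed.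

Lemma expandableD K a b : symbol_module K -> expandable K a ->
  expandable K b -> expandable K (fun eps k => a eps k + b eps k).
Proof.
move=> HK ea eb; apply: (expandable_coind (G := fun g => exists a b,
  [/\ expandable K a, expandable K b & g = fun eps k => a eps k + b eps k])) => //.
- move=> _ [u [v [eu ev ->]]]; split.
    by apply: (sm_add HK); exact: expandable_bounded.
  have [c [u' [_ eu' uE]]] := expandable_step HK eu.
  have [d [v' [_ ev' vE]]] := expandable_step HK ev.
  exists (fun k => c k + d k), (fun eps k => u' eps k + v' eps k); split.
    by exists u', v'.
  near=> eps => k.
  have -> : u eps k = c k + eps%:C * u' eps k by move: k; near: eps.
  have -> : v eps k = d k + eps%:C * v' eps k by move: k; near: eps.
  by ring.
- by exists a, b.
Unshelve. all: by end_near. Qed.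

Lemma expandable_fixedM K c a : symbol_module K -> symbol (fun _ => c) ->
  expandable K a -> expandable K (fun eps k => c k * a eps k).
Proof.
move=> HK sc ea; apply: (expandable_coind (G := fun g => exists2 a,
  expandable K a & g = fun eps k => c k * a eps k)) => //.
- move=> _ [u eu ->]; split.
    by apply: (sm_mul HK) => //; exact: expandable_bounded.
  have [d [u' [_ eu' uE]]] := expandable_step HK eu.
  exists (fun k => c k * d k), (fun eps k => c k * u' eps k); split.
    by exists u'.
  near=> eps => k.
  have -> : u eps k = d k + eps%:C * u' eps k by move: k; near: eps.
  by ring.
- by exists a.
Unshelve. all: by end_near. Qed.

(** The engine of the calculus. If [b] is only known through a fixed point
    equation in which [b] reappears multiplied by [eps], then the class of
    families [u + v * b], with [u] and [v] expandable, is closed under the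
    division step: where [b] is multiplied by the leading coefficient of [v],
    substituting the equation produces a family of the same form. For [h = 0] this gives
    products, and for [b] the inverse of [a] it gives inverses. *)
Lemma expandable_affine K b c f h u v : symbol_module K ->
  K b -> near_eq b (fun eps k => c k + eps%:C * (f eps k + h eps k * b eps k)) ->
  expandable K f -> expandable symbol h ->
  expandable K u -> expandable symbol v ->
  expandable K (fun eps k => u eps k + v eps k * b eps k).
Proof.
move=> HK Kb bE ef eh eu ev; have HS := @symbol_moduleS R.
apply: (expandable_coind (G := fun g => exists u v,
  [/\ expandable K u, expandable symbol v &
      g = fun eps k => u eps k + v eps k * b eps k])) => //.
- move=> _ [{}u [{}v [{}eu {}ev ->]]]; split.
    apply: (sm_add HK); first exact: expandable_bounded.
    by apply: (sm_mul HK) => //; exact: (expandable_bounded HS).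
  have [d [u' [_ eu' uE]]] := expandable_step HK eu.
  have [e [v' [se ev' vE]]] := expandable_step HS ev.
  exists (fun k => d k + e k * c k),
    (fun eps k => (u' eps k + e k * f eps k) +
                  (e k * h eps k + v' eps k) * b eps k); split.
    exists (fun eps k => u' eps k + e k * f eps k),
           (fun eps k => e k * h eps k + v' eps k); split=> //.
      by apply: (expandableD HK) => //; exact: expandable_fixedM.
    by apply: (expandableD HS) => //; exact: expandable_fixedM.
  near=> eps => k.
  have -> : u eps k = d k + eps%:C * u' eps k by move: k; near: eps.
  have -> : v eps k = e k + eps%:C * v' eps k by move: k; near: eps.
  have E : b eps k = c k + eps%:C * (f eps k + h eps k * b eps k).
    by move: k; near: eps.
  (* Only the occurrence of [b] multiplied by [e] is expanded. *)
  by rewrite mulrDl {1}E; ring.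
- by exists u, v.
Unshelve. all: by end_near. Qed.

Lemma expandable0 K a : symbol_module K -> K a ->
  expandable K (fun _ _ => 0).
Proof.
move=> HK Ka; apply: expandable_fixed => //.
apply: (sm_ext HK) (sm_mul HK (symbol_eps 0) Ka).
by near=> eps => k; rewrite !mul0r.
Unshelve. all: by end_near. Qed.

Lemma expandableM K v b : symbol_module K -> expandable symbol v ->
  expandable K b -> expandable K (fun eps k => v eps k * b eps k).
Proof.
move=> HK ev eb; have Kb := expandable_bounded HK eb.
have [c [b' [_ eb' bE]]] := expandable_step HK eb.
have HS := @symbol_moduleS R.
apply: (expandable_ext HK (a := fun eps k => 0 + v eps k * b eps k)).
  by near=> eps => k; rewrite add0r.
apply: (expandable_affine (c := c) (f := b') (h := fun _ _ => 0)) => //.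
- by near=> eps => k; rewrite mul0r addr0; move: k; near: eps.
- exact: expandable0 HS (symbol_eps 0).
- exact: expandable0 Kb.
Unshelve. all: by end_near. Qed.

Lemma expandable_real (x : R) : expandable symbol (fun _ _ => x%:C).
Proof.
apply: expandable_fixed; first exact: symbol_moduleS.
by apply: (@symbol_scalar _ (fun=> x) `|x|); near=> eps.
Unshelve. all: by end_near. Qed.

Lemma expandable_eps : expandable symbol (fun (eps : R) _ => eps%:C).
Proof.
exists (fun j _ => (j == 1%N)%:R) => N.
have HS := @symbol_moduleS R; case: N => [|[|N]].
- apply: (sm_ext HS) (symbol_eps 1); near=> eps => k.
  by rewrite /remainder big_ord0 subr0 expr0 divr1 mul1r.
- apply: (sm_ext HS) (@symbol_scalar _ (fun=> 1) 1 _); last first.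
    by near=> eps; rewrite normr1.
  near=> eps => k; rewrite /remainder big_ord1/= mulr0 subr0 expr1 divff//.
  by rewrite fmorph_eq0; near: eps; exact: near_neq0.
- apply: (sm_ext HS) (symbol_eps 0); near=> eps => k.
  rewrite /remainder 2!big_ord_recl big1/=; last by move=> i _; rewrite mulr0.
  by rewrite mulr0 add0r addr0 mulr1 expr1 subrr !mul0r.
Unshelve. all: by end_near. Qed.

(** A lower bound that is uniform in eps survives the limit at each fixed wave
    number, although the convergence need not be uniform in [k]. *)
Lemma coercive_leading_term a c a' (C : R) : symbol a' ->
  near_eq a (fun eps k => c k + eps%:C * a' eps k) ->
  (\forall eps \near 0^'+, forall k, C <= nrm (a eps k)) ->
  forall k, C <= nrm (c k).
Proof.
move=> [[D [s Ds]] _] aE Ca k; apply/ler_addgt0Pr => e e0.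
(* The point eps may depend on [k]: it makes eps times the remainder small. *)
pose M := `|D * weight k ^+ s| + 1.
have M0 : 0 < M by rewrite ltr_pwDr.
near (0 : R)^'+ => eps.
have eps0 : 0 < eps by near: eps; exact: nbhs_right_gt.
have epsM : eps * M <= e.
  rewrite -ler_pdivlMr//; near: eps; apply: nbhs_right_le.
  by rewrite divr_gt0.
have h1 : C <= nrm (a eps k) by move: (k); near: eps.
have h2 : nrm (a' eps k) <= D * weight k ^+ s by move: (k); near: eps.
have h3 : a eps k = c k + eps%:C * a' eps k by move: (k); near: eps.
rewrite h3 in h1; apply: (le_trans h1); apply: (le_trans (ler_normcD _ _)).
rewrite lerD2l ComplexField.Normc.normcM normc_real gtr0_norm//.
apply: le_trans epsM; rewrite ler_pM2l//; apply: (le_trans h2).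
by rewrite (le_trans (ler_norm _))// lerDl.
Unshelve. all: by end_near. Qed.

(** Writing [a = c + eps * a'], the inverse satisfies
    [a^-1 = c^-1 - eps * (c^-1 * a') * a^-1], which is the fixed point equation
    of [expandable_affine]. *)
Lemma expandableV a (C : R) : 0 < C -> expandable symbol a ->
  (\forall eps \near 0^'+, forall k, C <= nrm (a eps k)) ->
  expandable symbol (fun eps k => (a eps k)^-1).
Proof.
move=> C0 ea Ca; have HS := @symbol_moduleS R.
have [c [a' [[_ hc] ea' aE]]] := expandable_step HS ea.
have [_ ha] := expandable_bounded HS ea.
have Cc := coercive_leading_term (expandable_bounded HS ea') aE Ca.
have nz z : C <= nrm z -> z != 0.
  by move=> Cz; apply: contraTneq (lt_le_trans C0 Cz) => ->;
    rewrite ComplexField.Normc.normc0 ltxx.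
have bV z : C <= nrm z -> nrm z^-1 <= C^-1.
  move=> Cz; rewrite ComplexField.Normc.normcV lef_pV2// posrE//.
  exact: lt_le_trans Cz.
have sV : symbol (fun eps k => (a eps k)^-1).
  split.
    by exists C^-1, 0%N; near=> eps => k; rewrite expr0 mulr1 bV//;
      move: k; near: eps.
  by near=> eps => k; rewrite conjc_inv; congr (_^-1);
    move: k; near: eps.
have scV : symbol (fun _ k => (c k)^-1).
  apply: (@symbol_fixed_bound _ _ C^-1 0%N) => k; first by rewrite expr0 mulr1 bV.
  near (0 : R)^'+ => eps.
  have -> : c (- k) = (c k)^*%C by move: (k); near: eps.
  by rewrite conjc_inv.
apply: (expandable_ext HS (a := fun eps k => 0 + 1%:C * (a eps k)^-1)).
  by near=> eps => k; rewrite add0r mul1r.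
apply: (expandable_affine (c := fun k => (c k)^-1) (f := fun _ _ => 0)
  (h := fun eps k => (-1)%:C * ((c k)^-1 * a' eps k))) => //.
- near=> eps => k; have aN0 : a eps k != 0.
    by apply: nz; move: k; near: eps.
  have cN0 := nz _ (Cc k).
  have aE' : a eps k = c k + eps%:C * a' eps k by move: k {aN0 cN0}; near: eps.
  have E : eps%:C * a' eps k = a eps k - c k by rewrite aE'; ring.
  transitivity ((c k)^-1 - (c k)^-1 * (a eps k)^-1 * (eps%:C * a' eps k)).
    by rewrite E; field; rewrite aN0 cN0.
  by rewrite rmorphN/= rmorph1; ring.
- exact: expandable0 HS sV.
- apply: (expandableM HS); first exact: expandable_real.
  exact: (expandable_fixedM HS).
- exact: expandable0 HS sV.
- exact: expandable_real.
Unshelve. all: by end_near. Qed.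

(** Boundedness of the family itself follows from the remainder of order one. *)
Lemma expandableI K a (c : nat -> int -> R[i]) : symbol_module K -> K (fun _ => c 0%N) ->
  (forall N, K (remainder a c N.+1)) -> expandable K a.
Proof.
move=> HK Kc Ka; exists c => -[|N]; last exact: Ka.
apply: (sm_ext HK) (sm_add HK Kc (sm_mul HK (symbol_eps 1) (Ka 0%N))).
near=> eps => k; rewrite /remainder big_ord0 big_ord1 expr0 expr1 !mul1r.
rewrite subr0 divr1.
have e0 : eps%:C != 0 :> R[i].
  by rewrite fmorph_eq0; near: eps; exact: near_neq0.
by field.
Unshelve. all: by end_near. Qed.

Lemma expandable_scalar (g : R -> R) (c : nat -> R) : scalar_expansion g c ->
  expandable symbol (fun eps _ => (g eps)%:C).
Proof.
move=> gc; have HS := @symbol_moduleS R.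
apply: (expandableI (c := fun j _ => (c j)%:C)) => // [|N].
  exact: expandable_bounded HS (expandable_real (c 0%N)).
have [C gC] := gc N.
pose r eps := (g eps - \sum_(j < N.+1) eps ^+ j * c j) / eps ^+ N.+1.
apply: (sm_ext HS) (@symbol_scalar _ r C _).
  near=> eps => k; rewrite /remainder /r fmorph_div/= rmorphB rmorph_sum/=.
  by congr ((_ - _) / _); apply: eq_bigr => j _; rewrite rmorphM.
near=> eps; have eps0 : 0 < eps by near: eps; exact: nbhs_right_gt.
rewrite /r normf_div (@ger0_norm _ (eps ^+ N.+1)) ?exprn_ge0 ?(ltW eps0)//.
rewrite ler_pdivrMr ?exprn_gt0// -lee_fin; near: eps.
Unshelve. all: by end_near. Qed.

End ExpansionCalculus.

(** * Solving the dispersion relation *)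

Section Dispersion.
Context {R : realType}.
Local Notation nrm := (@ComplexField.Normc.normc R).
Implicit Types (a b f h u v : R -> int -> R[i]) (c : nat -> int -> R[i]).
Implicit Types K : (R -> int -> R[i]) -> Prop.

(** The Fourier multiplier of the derivative. *)
Definition ik (k : int) : R[i] := Complex 0 k%:~R.

Lemma normc_ge_normRe (z : R[i]) : `|complex.Re z| <= nrm z.
Proof.
by case: z => x y /=; rewrite -sqrtr_sqr ler_wsqrtr// lerDl sqr_ge0.
Qed.

Lemma ikN k : ik (- k) = (ik k)^*%C.
Proof. by rewrite /ik/= rmorphN. Qed.

Lemma symbol_ik : symbol (fun _ => ik).
Proof.
apply: (@symbol_fixed_bound _ _ 1 1%N) => [k|]; last exact: ikN.
rewrite mul1r expr1 /= expr0n add0r sqrtr_sqr /weight.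
have := sqr_ge0 (`|k%:~R| - 1 : R); have := normr_ge0 (k%:~R : R); nra.
Qed.

Lemma symbol_indicator (P : pred int) : (forall k, P (- k) = P k) ->
  symbol (fun (_ : R) k => (P k)%:R).
Proof.
move=> PN; apply: (@symbol_fixed_bound _ _ 1 0%N) => k.
  rewrite expr0 mulr1; case: (P k).
    by rewrite ComplexField.Normc.normc1.
  by rewrite ComplexField.Normc.normc0 ler01.
by rewrite PN rmorph_nat.
Qed.

(** The Fourier multiplier of the differential operator with constant
    coefficients [a0], [a1], [a2], [a3]. *)
Definition ode_symbol (a0 a1 a2 a3 : R) (k : int) : R[i] :=
  a0%:C + a1%:C * ik k + a2%:C * ik k ^+ 2 + a3%:C * ik k ^+ 3.

Section Equation.
Variables (w0 C : R) (w1 w2 w3 : R -> R) (A B : R -> int -> R[i]).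
Hypotheses (w0_lt0 : w0 < 0) (C_gt0 : 0 < C).
Hypothesis w2_ge : \forall eps \near 0^'+, C <= w2 eps.
Hypothesis w1_exp : expandable symbol (fun eps _ => (w1 eps)%:C).
Hypothesis w2_exp : expandable symbol (fun eps _ => (w2 eps)%:C).
Hypothesis w3_exp : expandable symbol (fun eps _ => (w3 eps)%:C).
Hypothesis A_exp : expandable rapid_symbol A.
Hypothesis BE : near_eq A (fun eps k =>
  ode_symbol w0 (w1 eps) (w2 eps / eps ^+ 2) (w3 eps / eps ^+ 2) k * B eps k).

(** Multiplying the equation by [eps ^+ 2] alone would make the factor of [B] at
    the mode [k = 0] vanish with eps. On that mode the unscaled equation is
    added, so that [dispersion], the factor of [B], stays away from zero
    uniformly in [k], while [numerator] is the resulting factor of [A]. *)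
Let numerator (eps : R) (k : int) : R[i] := (k == 0)%:R + eps%:C * eps%:C.
Let dispersion eps k : R[i] :=
  w0%:C * numerator eps k + (eps%:C * eps%:C) * ((w1 eps)%:C * ik k) +
  (w2 eps)%:C * (ik k * ik k) + (w3 eps)%:C * (ik k * (ik k * ik k)).

Let HS := @symbol_moduleS R.
Let HR := @symbol_moduleR R.

Let ik_exp : expandable symbol (fun _ => ik).
Proof. exact/expandable_fixed/symbol_ik. Qed.

Let eps2_exp : expandable symbol (fun (eps : R) _ => eps%:C * eps%:C).
Proof. by apply: expandableM => //; exact: expandable_eps. Qed.

Let numerator_exp : expandable symbol numerator.
Proof.
apply: expandableD => //; apply: expandable_fixed => //.
by apply: (symbol_indicator (P := pred1 0)) => k; rewrite /= oppr_eq0.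
Qed.

Let dispersion_exp : expandable symbol dispersion.
Proof.
apply: expandableD => //; first apply: expandableD => //;
  first apply: expandableD => //.
- by apply: expandableM => //; exact: expandable_real.
- by apply: expandableM => //; exact: expandableM.
- by do 2 apply: expandableM => //.
- by do 3 apply: expandableM => //.
Qed.

(** Only the real part is needed: since [ik] is purely imaginary, the odd
    derivatives do not contribute to it, and the two remaining terms have the
    same sign because [w0 < 0 < w2]. *)
Let dispersion_ge : \forall eps \near 0^'+, forall k,
  Num.min (- w0) C <= nrm (dispersion eps k).
Proof.
near=> eps => k; have w2C : C <= w2 eps by near: eps.
apply: le_trans (normc_ge_normRe _); rewrite -normrN; apply: le_trans (ler_norm _).
have -> : complex.Re (dispersion eps k) =
    w0 * ((k == 0)%:R + eps ^+ 2) - w2 eps * k%:~R ^+ 2.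
  by rewrite /dispersion /numerator /ik; case: (k == 0); simpc; rewrite /=; ring.
have [->|k0] := eqVneq k 0.
  rewrite expr0n/= mulr0 subr0 ge_min; apply/orP; left.
  have := mulr_le0_ge0 (ltW w0_lt0) (sqr_ge0 eps); lra.
rewrite ge_min; apply/orP; right.
have k1 : 1 <= k%:~R ^+ 2 :> R.
  rewrite -rmorphXn/= -(rmorph1 (intmul 1)) ler_int; lia.
rewrite mulr0n add0r opprB; apply: (@le_trans _ _ (w2 eps * k%:~R ^+ 2)).
  by rewrite -[leLHS]mulr1 ler_pM// ltW.
by rewrite lerDl oppr_ge0 mulr_le0_ge0 ?sqr_ge0// ltW.
Unshelve. all: by end_near. Qed.

Let dispersionB : near_eq (fun eps k => numerator eps k * A eps k)
  (fun eps k => dispersion eps k * B eps k).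
Proof.
near=> eps => k; have e0 : eps != 0 by near: eps; exact: near_neq0.
have -> : A eps k =
    ode_symbol w0 (w1 eps) (w2 eps / eps ^+ 2) (w3 eps / eps ^+ 2) k * B eps k.
  by move: k; near: eps.
have ec0 : eps%:C != 0 :> R[i] by rewrite fmorph_eq0.
rewrite /dispersion /numerator /ode_symbol !fmorph_div/= rmorphXn/=.
have [->|k0] := eqVneq k 0; last by rewrite mulr0n; field.
by rewrite /ik /= -[Complex 0 _]/(0 : R[i]) mulr1n; field.
Unshelve. all: by end_near. Qed.

Let B_quotient :
  near_eq (fun eps k => numerator eps k * ((dispersion eps k)^-1 * A eps k)) B.
Proof.
near=> eps => k; rewrite mulrCA.
have -> : numerator eps k * A eps k = dispersion eps k * B eps k.
  by move: k; near: eps; exact: dispersionB.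
rewrite mulKf//.
have : Num.min (- w0) C <= nrm (dispersion eps k).
  by move: k; near: eps; exact: dispersion_ge.
apply: contraTneq => ->; rewrite ComplexField.Normc.normc0 -ltNge lt_min.
by rewrite oppr_gt0 w0_lt0.
Unshelve. all: by end_near. Qed.

Let quotient_exp :
  expandable rapid_symbol (fun eps k => (dispersion eps k)^-1 * A eps k).
Proof.
apply: expandableM => //; apply: expandableV dispersion_ge => //.
by rewrite lt_min oppr_gt0 w0_lt0.
Qed.

(** The coefficients are a product of three expandable families, one of them
    the inverse of a symbol bounded away from zero. *)
Lemma dispersion_solution_expandable : expandable rapid_symbol B.
Proof. by apply: (expandable_ext HR B_quotient); exact: expandableM. Qed.

(** Away from [k = 0] the numerator is exactly [eps ^+ 2]. *)
Lemma dispersion_solution_oscillation : exists2 b, rapid_symbol b &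
  \forall eps \near 0^'+, forall k, k != 0 -> B eps k = (eps ^+ 2)%:C * b eps k.
Proof.
exists (fun eps k => (dispersion eps k)^-1 * A eps k).
  exact: expandable_bounded.
near=> eps => k k0.
have <- : numerator eps k * ((dispersion eps k)^-1 * A eps k) = B eps k.
  by move: (k); near: eps; exact: B_quotient.
by rewrite /numerator (negbTE k0) add0r expr2 rmorphM.
Unshelve. all: by end_near. Qed.

End Equation.
End Dispersion.

(** * Expansions of the coefficients omega *)

Section Coefficients.
Context {R : realType}.
Implicit Types g h : R -> R.

Lemma scalar_expansion_near g (c : nat -> R) e : scalar_expansion g c -> 0 < e ->
  \forall eps \near 0^'+, `|g eps - c 0%N| <= e.
Proof.
move=> /(_ 0%N)[C gC] e0; near=> eps.
have eps0 : 0 < eps by near: eps; exact: nbhs_right_gt.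
have : (`|g eps - \sum_(j < 1) eps ^+ j * c j|%:E <= (C * eps ^+ 1)%:E)%E.
  by near: eps.
rewrite big_ord1 expr0 mul1r expr1 lee_fin => /le_trans; apply.
apply: (@le_trans _ _ ((`|C| + 1) * eps)).
  by rewrite ler_wpM2r ?(ltW eps0)// (le_trans (ler_norm _))// lerDl.
rewrite mulrC -ler_pdivlMr ?ltr_pwDr//; near: eps; apply: nbhs_right_le.
by rewrite divr_gt0 ?ltr_pwDr.
Unshelve. all: by end_near. Qed.

Definition scalar_expandable g := expandable symbol (fun eps (_ : int) => (g eps)%:C).

Lemma scalar_expandable_ext g h : (\forall eps \near 0^'+, g eps = h eps) ->
  scalar_expandable g -> scalar_expandable h.
Proof.
move=> gh; apply: (expandable_ext symbol_moduleS).
by near=> eps => k; congr (_%:C); near: eps.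
Unshelve. all: by end_near. Qed.

Lemma scalar_expandableM g h : scalar_expandable g -> scalar_expandable h ->
  scalar_expandable (fun eps => g eps * h eps).
Proof.
move=> eg eh; apply: (expandable_ext symbol_moduleS)
  (expandableM symbol_moduleS eg eh).
by near=> eps => k; rewrite rmorphM.
Unshelve. all: by end_near. Qed.

Lemma scalar_expandableD g h : scalar_expandable g -> scalar_expandable h ->
  scalar_expandable (fun eps => g eps + h eps).
Proof.
move=> eg eh; apply: (expandable_ext symbol_moduleS)
  (expandableD symbol_moduleS eg eh).
by near=> eps => k; rewrite rmorphD.
Unshelve. all: by end_near. Qed.

Lemma scalar_expandableV g (C : R) : 0 < C ->
  (\forall eps \near 0^'+, C <= g eps) ->
  scalar_expandable g -> scalar_expandable (fun eps => (g eps)^-1).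
Proof.
move=> C0 gC eg; apply: (expandable_ext symbol_moduleS)
  (expandableV C0 eg _).
  by near=> eps => k; rewrite fmorphV.
near=> eps => k; rewrite normc_real; apply: le_trans (ler_norm _).
by near: eps.
Unshelve. all: by end_near. Qed.

Lemma scalar_expandable_cst (x : R) : scalar_expandable (fun=> x).
Proof. exact: expandable_real. Qed.

Section ReferenceState.
Variables (gamma dt eps0 : R) (rhoR uR ER pR : R -> R).
Variables (rhoR_ mR_ ER_ pR_ : nat -> R).
Hypotheses (gamma_gt1 : 1 < gamma) (dt_gt0 : 0 < dt) (eps0_gt0 : 0 < eps0).
Hypothesis eos : forall eps : R, 0 < eps <= eps0 ->
  ER eps = pR eps / (gamma - 1) + eps ^+ 2 / 2 * rhoR eps * uR eps ^+ 2.
Hypothesis rhoR_exp : scalar_expansion rhoR rhoR_.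
Hypothesis mR_exp : scalar_expansion (fun eps => rhoR eps * uR eps) mR_.
Hypothesis ER_exp : scalar_expansion ER ER_.
Hypothesis pR_exp : scalar_expansion pR pR_.
Hypotheses (rhoR0_gt0 : 0 < rhoR_ 0%N) (pR0_gt0 : 0 < pR_ 0%N).

Let half_rho0 : 0 < rhoR_ 0%N / 2. Proof. by rewrite divr_gt0. Qed.

Let rho_ge : \forall eps \near 0^'+, rhoR_ 0%N / 2 <= rhoR eps.
Proof.
have := scalar_expansion_near rhoR_exp half_rho0.
by apply: filterS => eps; rewrite ler_norml => /andP[+ _]; lra.
Qed.

Let rhoV_expandable : scalar_expandable (fun eps => (rhoR eps)^-1).
Proof.
exact: (scalar_expandableV half_rho0 rho_ge (expandable_scalar rhoR_exp)).
Qed.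

(** The velocity is the quotient of momentum by density. *)
Lemma velocity_expandable : scalar_expandable uR.
Proof.
apply: scalar_expandable_ext
  (scalar_expandableM rhoV_expandable (expandable_scalar mR_exp)).
near=> eps; rewrite mulKf// gt_eqF//; apply: (lt_le_trans half_rho0).
by near: eps.
Unshelve. all: by end_near. Qed.

Lemma omega1_expandable : scalar_expandable (fun eps => omega1 gamma dt (uR eps)).
Proof.
have := scalar_expandableM
  (scalar_expandable_cst (- dt * ((5 + gamma) / (2 * (gamma - 1)))))
  velocity_expandable.
by apply: scalar_expandable_ext; near=> eps; rewrite /omega1; ring.
Unshelve. all: by end_near. Qed.

Let linear_expandable (x y : R) : scalar_expandable
  (fun eps => (rhoR eps)^-1 * (x * ER eps + y * pR eps)).
Proof.
apply: scalar_expandableM => //; apply: scalar_expandableD;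
  apply: scalar_expandableM; try exact: scalar_expandable_cst.
  exact: expandable_scalar ER_exp.
exact: expandable_scalar pR_exp.
Qed.

Lemma omega2_expandable : scalar_expandable
  (fun eps => omega2 gamma dt (rhoR eps) (ER eps) (pR eps)).
Proof.
have := scalar_expandableM (scalar_expandable_cst (dt ^+ 2))
  (linear_expandable ((- gamma - 5) / (gamma - 1))
                     ((gamma ^+ 2 + 5) / (gamma - 1) ^+ 2)).
by apply: scalar_expandable_ext; near=> eps; rewrite mulrA.
Unshelve. all: by end_near. Qed.

Lemma omega3_expandable : scalar_expandable
  (fun eps => omega3 gamma dt (rhoR eps) (uR eps) (ER eps) (pR eps)).
Proof.
have := scalar_expandableM
  (scalar_expandableM (scalar_expandable_cst (dt ^+ 3)) velocity_expandable)
  (linear_expandable (- 2 / (gamma - 1))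
                     ((gamma ^+ 2 - gamma + 2) / (gamma - 1) ^+ 2)).
by apply: scalar_expandable_ext; near=> eps; rewrite mulrA.
Unshelve. all: by end_near. Qed.

(** The equation of state replaces the energy by the pressure. The two pressure
    terms combine, since [- (gamma + 5) + gamma ^+ 2 + 5] equals
    [gamma * (gamma - 1)], to a positive multiple of the pressure, and the
    kinetic energy only contributes a term of order [eps ^+ 2]. *)
Lemma omega2_bounded_below : exists2 C, 0 < C & \forall eps \near 0^'+,
  C <= omega2 gamma dt (rhoR eps) (ER eps) (pR eps).
Proof.
have g1 : 0 < gamma - 1 by rewrite subr_gt0.
(* [M] bounds the squared momentum, [q * eps ^+ 2] the kinetic term, and [P]
   bounds the pressure term below; half of [P] absorbs the kinetic term. *)
pose M := (`|mR_ 0%N| + 1) ^+ 2.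
pose q := (gamma + 5) / (gamma - 1) / rhoR_ 0%N * M.
have q0 : 0 < q.
  by rewrite !(divr_gt0, mulr_gt0)// ?exprn_gt0// ?ltr_pwDr//; lra.
pose P := gamma / (gamma - 1) * (pR_ 0%N / 2).
have P0 : 0 < P by rewrite mulr_gt0// divr_gt0//; lra.
exists (dt ^+ 2 / (rhoR_ 0%N + 1) * (P / 2)).
  by rewrite mulr_gt0 ?divr_gt0 ?exprn_gt0 ?addr_gt0.
near=> eps.
have epos : 0 < eps by near: eps; exact: nbhs_right_gt.
have ele : eps <= eps0 by near: eps; exact: nbhs_right_le.
have e1 : eps <= 1 by near: eps; exact: nbhs_right_le.
have eq : q * eps <= P / 2.
  rewrite mulrC -ler_pdivlMr//; near: eps; apply: nbhs_right_le.
  by rewrite !divr_gt0.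
have rge : rhoR_ 0%N / 2 <= rhoR eps by near: eps.
have r0 : 0 < rhoR eps := lt_le_trans half_rho0 rge.
have rle : rhoR eps <= rhoR_ 0%N + 1.
  have : `|rhoR eps - rhoR_ 0%N| <= 1.
    by near: eps; exact: scalar_expansion_near rhoR_exp ltr01.
  by rewrite ler_norml => /andP[_]; lra.
have pge : pR_ 0%N / 2 <= pR eps.
  have : `|pR eps - pR_ 0%N| <= pR_ 0%N / 2.
    by near: eps; apply: scalar_expansion_near pR_exp _; rewrite divr_gt0.
  by rewrite ler_norml => /andP[+ _]; lra.
have mle : (rhoR eps * uR eps) ^+ 2 <= M.
  have : `|rhoR eps * uR eps - mR_ 0%N| <= 1.
    by near: eps; exact: scalar_expansion_near mR_exp ltr01.
  rewrite /M -(real_normK (num_real (_ * _))) => h.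
  rewrite ler_sqr ?nnegrE ?addr_ge0// -lerBlDl.
  exact: le_trans (lerB_dist _ _) h.
have -> : omega2 gamma dt (rhoR eps) (ER eps) (pR eps) = dt ^+ 2 / rhoR eps *
   (gamma / (gamma - 1) * pR eps - (gamma + 5) / (gamma - 1) / (2 * rhoR eps) *
      (rhoR eps * uR eps) ^+ 2 * eps ^+ 2).
  rewrite /omega2 eos; last by rewrite epos.
  by field; rewrite !gt_eqF.
have kin : (gamma + 5) / (gamma - 1) / (2 * rhoR eps) *
      (rhoR eps * uR eps) ^+ 2 * eps ^+ 2 <= P / 2.
  apply: le_trans eq; rewrite expr2 [leLHS]mulrA ler_pM2r//.
  rewrite -[q]mulr1; apply: ler_pM => //.
    by rewrite mulr_ge0 ?sqr_ge0// divr_ge0// ?divr_ge0//; lra.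
  apply: ler_pM; rewrite ?sqr_ge0//.
    by rewrite divr_ge0// ?divr_ge0//; lra.
  rewrite ler_pM2l; last by rewrite divr_gt0//; lra.
  by rewrite lef_pV2 ?posrE// ?mulr_gt0//; lra.
apply: ler_pM.
- by rewrite divr_ge0 ?sqr_ge0// addr_ge0// ltW.
- by rewrite divr_ge0// ltW.
- by rewrite ler_pM2l ?exprn_gt0// lef_pV2// posrE addr_gt0.
have : P <= gamma / (gamma - 1) * pR eps.
  by rewrite ler_pM2l// divr_gt0//; lra.
lra.
Unshelve. all: by end_near. Qed.

End ReferenceState.
End Coefficients.

(** * Fourier coefficients of periodic square-integrable functions *)

Section Fourier.
Context {R : realType}.
Local Notation mu := (@lebesgue_measure R).
Implicit Types f g h : R -> R.

(** The carrier is ascribed so that the measurable structure is the one on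
    which the Lebesgue measure is defined. *)
Lemma measurable_Omega : measurable (@Omega R : set (measurableTypeR R)).
Proof. exact: measurable_itv. Qed.
Hint Resolve measurable_Omega : core.

Lemma measure_Omega : mu Omega = (pi *+ 2)%:E.
Proof.
rewrite /Omega lebesgue_measure_itv/= lte_fin gtrN ?pi_gt0//.
by rewrite -EFinB opprK mulr2n.
Qed.

Lemma integrable_Omega_cst (x : R) : mu.-integrable Omega (EFin \o cst x).
Proof.
apply/integrableP; split; first exact/measurable_EFinP.
rewrite (eq_integral (cst `|x|%:E))//= integral_cst//= measure_Omega.
by rewrite -EFinM ltry.
Qed.

(** By [2 * |f| <= 1 + f ^+ 2] on a set of finite measure. *)
Lemma L2per_integrableM f h (M : R) : L2per f -> measurable_fun setT h ->
  (forall x, `|h x| <= M) ->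
  mu.-integrable Omega (EFin \o (fun x => f x * h x)).
Proof.
move=> [_ mf if2] mh hM.
have M0 : 0 <= M by exact: le_trans (hM 0).
apply: (le_integrable measurable_Omega (g := fun x =>
  (M%:E * (1%:E + (f x ^+ 2)%:E))%E)).
- apply/measurable_EFinP/(measurable_funS measurableT (@subsetT _ _)).
  exact: measurable_funM.
- move=> x _; rewrite /= lee_fin normrM mulrC [leRHS]ger0_norm; last first.
    by rewrite mulr_ge0// addr_ge0 ?sqr_ge0.
  apply: ler_pM => //; rewrite -(real_normK (num_real (f x))).
  by have := sqr_ge0 (`|f x| - 1); have := normr_ge0 (f x); nra.
- apply: integrableZl => //; apply: integrableD => //.
  exact: (integrable_Omega_cst 1).
Qed.

Lemma L2per_affine f g (a : R) : L2per f -> L2per g ->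
  L2per (fun x => f x + a * g x).
Proof.
move=> [pf mf if2] [pg mg ig2]; split.
- by move=> x; rewrite pf pg.
- by apply: measurable_funD => //; exact: measurable_funM.
- apply: (le_integrable measurable_Omega (g := fun x =>
    (2%:E * (f x ^+ 2)%:E + (2 * a ^+ 2)%:E * (g x ^+ 2)%:E)%E)).
  + apply/measurable_EFinP/(measurable_funS measurableT (@subsetT _ _)).
    apply: measurable_funX; apply: measurable_funD => //.
    exact: measurable_funM.
  + move=> x _; rewrite /= lee_fin [leLHS]ger0_norm ?sqr_ge0//.
    apply: le_trans (ler_norm _).
    by have := sqr_ge0 (f x - a * g x); nra.
  + by apply: integrableD => //; exact: integrableZl.
Qed.

Lemma bounded_L2per f (M : R) : periodic f (pi *+ 2) -> measurable_fun setT f ->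
  (forall x, `|f x| <= M) -> L2per f.
Proof.
move=> pf mf fM; split => //.
apply: (le_integrable measurable_Omega (g := EFin \o cst (M ^+ 2))).
- apply/measurable_EFinP/(measurable_funS measurableT (@subsetT _ _)).
  exact: measurable_funX.
- move=> x _; rewrite /= lee_fin !normrX ler_sqr ?nnegrE//.
  by rewrite (le_trans (fM x))// ler_norm.
- exact: integrable_Omega_cst.
Qed.

Lemma L2per_cst (x : R) : L2per (fun=> x).
Proof. by apply: (@bounded_L2per _ `|x|). Qed.

Lemma measurable_cosM (y : R) : measurable_fun setT (fun x : R => cos (y * x)).
Proof.
apply: (measurableT_comp (f := cos)); last exact: measurable_funM.
by apply: continuous_measurable_fun; exact: continuous_cos.
Qed.

Lemma measurable_sinM (y : R) : measurable_fun setT (fun x : R => sin (y * x)).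
Proof.
apply: (measurableT_comp (f := sin)); last exact: measurable_funM.
by apply: continuous_measurable_fun; exact: continuous_sin.
Qed.

Lemma normr_cos_le1 (x : R) : `|cos x| <= 1.
Proof. by rewrite ler_norml cos_geN1 cos_le1. Qed.

Lemma normr_sin_le1 (x : R) : `|sin x| <= 1.
Proof. by rewrite ler_norml sin_geN1 sin_le1. Qed.

Lemma integrable_fcos f (y : R) : L2per f ->
  mu.-integrable Omega (EFin \o (fun x => f x * cos (y * x))).
Proof.
move=> Lf; apply: (L2per_integrableM (M := 1) Lf); first exact: measurable_cosM.
by move=> x; exact: normr_cos_le1.
Qed.

Lemma integrable_fsin f (y : R) : L2per f ->
  mu.-integrable Omega (EFin \o (fun x => f x * sin (y * x))).
Proof.
move=> Lf; apply: (L2per_integrableM (M := 1) Lf); first exact: measurable_sinM.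
by move=> x; exact: normr_sin_le1.
Qed.

Lemma Rintegral_affineM f g h (a : R) :
  mu.-integrable Omega (EFin \o (fun x => f x * h x)) ->
  mu.-integrable Omega (EFin \o (fun x => g x * h x)) ->
  \int[mu]_(x in Omega) ((f x + a * g x) * h x) =
  \int[mu]_(x in Omega) (f x * h x) + a * \int[mu]_(x in Omega) (g x * h x).
Proof.
move=> fh gh; rewrite -RintegralZl// -RintegralD//; last first.
  rewrite (_ : _ \o _ = (fun x => a%:E * (EFin \o (fun x => g x * h x)%R) x)%E).
    exact: integrableZl.
  by apply/funext => x.
by apply: eq_Rintegral => x _; rewrite mulrDl mulrA.
Qed.

Lemma fourier0 k : fourier (fun _ : R => 0) k = 0.
Proof.
have E (h : R -> R) : \int[mu]_(x in Omega) (0 * h x) = 0.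
  under eq_Rintegral do rewrite mul0r.
  by rewrite (Rintegral_cst _ measurable_Omega) mul0r.
by rewrite /fourier !E mulr0 oppr0.
Qed.

Lemma fourier_affine f g (a : R) k : L2per f -> L2per g ->
  fourier (fun x => f x + a * g x) k = fourier f k + a%:C * fourier g k.
Proof.
move=> Lf Lg; rewrite /fourier !Rintegral_affineM;
  [|exact: integrable_fsin..|exact: integrable_fcos|exact: integrable_fcos].
by apply/eqP; rewrite eq_complex/=; apply/andP; split; apply/eqP; ring.
Qed.

Lemma fourierN f k : L2per f -> fourier f (- k) = (fourier f k)^*%C.
Proof.
move=> Lf; rewrite /fourier /= rmorphN/= opprK; congr Complex.
  by congr (_ * _); apply: eq_Rintegral => x _; rewrite mulNr cosN.
rewrite -mulrN -mulN1r -RintegralZl//; last exact: integrable_fsin.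
by congr (_ * _); apply: eq_Rintegral => x _; rewrite (mulNr k%:~R) sinN; ring.
Qed.

Lemma fourier_ae f g k : measurable_fun setT f -> measurable_fun setT g ->
  {ae mu, forall x, Omega x -> f x = g x} -> fourier f k = fourier g k.
Proof.
move=> mf mg fg.
have E h : measurable_fun setT h ->
    \int[mu]_(x in Omega) (f x * h x) = \int[mu]_(x in Omega) (g x * h x).
  move=> mh; congr fine; apply: ae_eq_integral => //.
  - apply/measurable_EFinP/(measurable_funS measurableT (@subsetT _ _)).
    exact: measurable_funM.
  - apply/measurable_EFinP/(measurable_funS measurableT (@subsetT _ _)).
    exact: measurable_funM.
  - move: fg; apply: (@filterS _ _ (ae_filter_ringOfSetsType mu)) => x + Ox.
    by move=> /(_ Ox) /= ->.
by rewrite /fourier !E//; [exact: measurable_sinM|exact: measurable_cosM].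
Qed.

(** The real part of [z * exp (- i k x)]. The complex amplitude makes a single
    family of test functions out of cosines and sines, stable under
    differentiation, and pairing with it recovers a complex Fourier
    coefficient from real integrals. *)
Definition wave (k : int) (z : R[i]) (x : R) : R :=
  complex.Re z * cos (k%:~R * x) + complex.Im z * sin (k%:~R * x).

Lemma Rintegral_mul_wave f k (z : R[i]) : L2per f ->
  \int[mu]_(x in Omega) (f x * wave k z x) =
  complex.Re (z * ((pi *+ 2)%:C * fourier f k)).
Proof.
move=> Lf; have ic := integrable_fcos k%:~R Lf; have jc := integrable_fsin k%:~R Lf.
have p0 : pi *+ 2 != 0 :> R by rewrite gt_eqF// pmulrn_lgt0// pi_gt0.
transitivity (complex.Re z * \int[mu]_(x in Omega) (f x * cos (k%:~R * x)) +
   complex.Im z * \int[mu]_(x in Omega) (f x * sin (k%:~R * x))).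
  have H a (h : R -> R) : mu.-integrable Omega (EFin \o h) ->
      mu.-integrable Omega (EFin \o (fun x => a * h x)).
    move=> ih; rewrite (_ : _ \o _ = (fun x => a%:E * (EFin \o h) x)%E).
      exact: integrableZl.
    by apply/funext => x.
  rewrite -!RintegralZl// -RintegralD//; [|exact: H..].
  by apply: eq_Rintegral => x _; rewrite /wave; ring.
case: z => a b; rewrite /fourier; simpc; rewrite /=.
move: (\int[mu]_(x in Omega) (f x * cos (k%:~R * x)))
  (\int[mu]_(x in Omega) (f x * sin (k%:~R * x))) => C S.
by rewrite !mulVKf// mulrN mulVKf// opprK.
Qed.

Lemma is_derive_wave k (z : R[i]) (x : R) :
  is_derive x 1 (wave k z) (wave k (- ik k * z) x).
Proof.
have dk : is_derive x (1 : R) (fun y : R => k%:~R * y) k%:~R.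
  have := is_deriveZ (k%:~R : R) (is_derive_id x (1 : R)).
  by rewrite /GRing.scale/= mulr1.
have dc := is_derive1_comp (is_derive_cos (k%:~R * x)) dk.
have ds := is_derive1_comp (is_derive_sin (k%:~R * x)) dk.
have := is_deriveD (is_deriveZ (complex.Re z) dc) (is_deriveZ (complex.Im z) ds).
move=> /is_derive_eq; apply.
rewrite /wave /ik /GRing.scale; case: z => a b; simpc; rewrite /=; ring.
Qed.

Lemma derive1n_wave n k (z : R[i]) :
  derive1n n (wave k z) = wave k ((- ik k) ^+ n * z).
Proof.
elim: n => [|n IH]; first by rewrite derive1n0 expr0 mul1r.
rewrite derive1nS IH; apply/funext => x.
by rewrite derive1E exprS -mulrA; apply/derive_val/is_derive_wave.
Qed.

Lemma cosDint2pi (x : R) (k : int) : cos (x + k%:~R * (pi *+ 2)) = cos x.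
Proof.
case: k => n.
  by rewrite -pmulrn mulr_natl; exact: (periodicn (@cosD2pi R)).
rewrite NegzE mulrNz mulNr -[in RHS](subrK (n.+1%:R * (pi *+ 2)) x).
by rewrite pmulrn mulr_natl (periodicn (@cosD2pi R)).
Qed.

Lemma sinDint2pi (x : R) (k : int) : sin (x + k%:~R * (pi *+ 2)) = sin x.
Proof.
case: k => n.
  by rewrite -pmulrn mulr_natl; exact: (periodicn (@sinD2pi R)).
rewrite NegzE mulrNz mulNr -[in RHS](subrK (n.+1%:R * (pi *+ 2)) x).
by rewrite pmulrn mulr_natl (periodicn (@sinD2pi R)).
Qed.

Lemma periodic_wave k (z : R[i]) : periodic (wave k z) (pi *+ 2).
Proof. by move=> x; rewrite /wave mulrDr cosDint2pi sinDint2pi. Qed.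

Lemma test_function_wave k (z : R[i]) : test_function (wave k z).
Proof.
split; first exact: periodic_wave.
move=> n x; rewrite derive1n_wave.
by have d := is_derive_wave k ((- ik k) ^+ n * z) x; exact: ex_derive.
Qed.

Lemma complex_eq_Re (x y : R[i]) :
  (forall z, complex.Re (z * x) = complex.Re (z * y)) -> x = y.
Proof.
case: x y => [a b] [c d] E; have := E 1; have := E (Complex 0 (-1)).
by simpc => /= -> ->.
Qed.

(** Waves are admissible test functions, and each of the [n] derivatives
    multiplies their amplitude by [- ik k]; the sign is the one in the
    definition of a weak derivative. *)
Lemma fourier_weak_derivative n f g k : L2per f -> weak_derivative n f g ->
  fourier g k = ik k ^+ n * fourier f k.
Proof.
move=> Lf [Lg /(_ _ (test_function_wave k _)) gf].
have E (z : R[i]) : complex.Re (z * ((pi *+ 2)%:C * fourier g k)) =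
    complex.Re (z * ((pi *+ 2)%:C * (ik k ^+ n * fourier f k))).
  rewrite -Rintegral_mul_wave// gf derive1n_wave Rintegral_mul_wave//.
  have -> : (-1) ^+ n = complex.Re ((-1) ^+ n)%:C :> R by [].
  set w := (- ik k) ^+ n * z * _.
  have -> : z * ((pi *+ 2)%:C * (ik k ^+ n * fourier f k)) = ((-1) ^+ n)%:C * w.
    rewrite /w -[- ik k]mulN1r exprMn rmorphXn/= rmorphN1 !mulrA -expr2 -exprM.
    by rewrite mulnC exprM sqrrN expr1n expr1n mul1r; ring.
  by case: (w) => a b; simpc.
have p0 : (pi *+ 2)%:C != 0 :> R[i].
  by rewrite fmorph_eq0 gt_eqF// pmulrn_lgt0// pi_gt0.
by apply: (mulfI p0); exact: complex_eq_Re.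
Qed.

Lemma fourier_ode (a0 a1 a2 a3 : R) f g k : L2per f -> measurable_fun setT g ->
  periodic_ode3 a0 a1 a2 a3 f g ->
  fourier g k = ode_symbol a0 a1 a2 a3 k * fourier f k.
Proof.
move=> Lf mg [f1 [f2 [f3 [w1 w2 w3 fg]]]].
have [L1 _] := w1; have [L2 _] := w2; have [L3 _] := w3.
have L0 := L2per_affine a0 (L2per_cst 0) Lf.
have L01 := L2per_affine a1 L0 L1.
have L012 := L2per_affine a2 L01 L2.
have L0123 := L2per_affine a3 L012 L3.
have -> : fourier g k =
    fourier (fun x => 0 + a0 * f x + a1 * f1 x + a2 * f2 x + a3 * f3 x) k.
  apply: fourier_ae => //; first by case: L0123.
  move: fg; apply: (@filterS _ _ (ae_filter_ringOfSetsType mu)) => x + Ox.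
  by move=> /(_ Ox) <-; rewrite /= add0r.
rewrite (fourier_affine _ _ L012 L3) (fourier_affine _ _ L01 L2).
rewrite (fourier_affine _ _ L0 L1) (fourier_affine _ _ (L2per_cst 0) Lf) fourier0 add0r.
rewrite (fourier_weak_derivative k Lf w1) (fourier_weak_derivative k Lf w2).
by rewrite (fourier_weak_derivative k Lf w3) /ode_symbol; ring.
Qed.

End Fourier.

(** * Sobolev norms as decay of Fourier coefficients *)

Section Sobolev.
Context {R : realType}.
Local Notation nrm := (@ComplexField.Normc.normc R).
Implicit Types (f : R -> R) (r : R -> int -> R[i]).

Lemma sobolev_sqnorm_ge0 p f : (0 <= sobolev_sqnorm p f)%E.
Proof.
by apply: esum_ge0 => k _; rewrite lee_fin mulr_ge0 ?sqr_ge0.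
Qed.

Lemma sobolev_term_le p f k :
  ((weight k ^+ p * nrm (fourier f k) ^+ 2)%:E <= sobolev_sqnorm p f)%E.
Proof.
apply: esum_ge; exists [set k]; last by rewrite fsbig_set1.
by split => //; exact: finite_set1.
Qed.

(** A single term of the series is at most its sum. The order is doubled since
    the squared norm contains the square of the coefficient, but only the first
    power of [weight k ^+ p]. *)
Lemma sobolev_coefficient_le p f (x : R) k : 0 <= x ->
  (sobolev_norm (p + p) f <= x%:E)%E -> weight k ^+ p * nrm (fourier f k) <= x.
Proof.
move=> x0; rewrite /sobolev_norm poweR12_sqrt ?sobolev_sqnorm_ge0// => Sx.
have x0E : (0 <= x%:E)%E by rewrite lee_fin.
rewrite -[x%:E]gee0_abs// -sqrte_sqr lee_sqrt ?sqre_ge0// in Sx.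
have := le_trans (sobolev_term_le (p + p) f k) Sx.
rewrite -EFin_expe lee_fin exprD -expr2 -exprMn ler_sqr//.
by rewrite nnegrE mulr_ge0 ?normc_ge0// ltW// weightX_gt0.
Qed.

(** Comparison with the telescoping series of
    [4 / ((n + 1) * (n + 2))]. *)
Lemma sum_inv_sqr_le N : \sum_(0 <= n < N) (1 + (n%:R : R) ^+ 2)^-1 <= 4.
Proof.
(* The telescoped partial sum, which is what the induction can carry. *)
suff : \sum_(0 <= n < N) (1 + (n%:R : R) ^+ 2)^-1 <= 4 - 4 / N.+1%:R.
  by move=> /le_trans; apply; rewrite lerBlDr lerDl divr_ge0.
elim: N => [|N IH]; first by rewrite big_nil divr1 subrr.
rewrite big_nat_recr//= -lerBrDr; apply: (le_trans IH).
rewrite -!natr1; set x := N%:R : R; have x0 : 0 <= x by exact: ler0n.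
suff : (1 + x ^+ 2)^-1 <= 4 / (x + 1) - 4 / (x + 1 + 1) by lra.
have -> : 4 / (x + 1) - 4 / (x + 1 + 1) = ((x + 1) * (x + 1 + 1) / 4)^-1.
  by field; rewrite !gt_eqF//; lra.
rewrite lef_pV2 ?posrE ?divr_gt0 ?mulr_gt0//; first by nra.
all: nra.
Qed.

Lemma nneseries_inv_weight_le (y : R) (e : nat -> int) : 0 <= y ->
  (forall n, n%:R <= `|(e n)%:~R| :> R) ->
  (\sum_(0 <= n <oo) (y / weight (e n))%:E <= (4 * y)%:E)%E.
Proof.
move=> y0 en; apply: lime_le.
  apply: is_cvg_nneseries => n _ _.
  by rewrite lee_fin divr_ge0// ltW// weight_gt0.
apply: nearW => N; rewrite sumEFin lee_fin -mulr_sumr mulrC ler_wpM2r//.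
apply: le_trans (sum_inv_sqr_le N); apply: ler_sum => n _.
rewrite lef_pV2 ?posrE ?weight_gt0 ?ltr_pwDl ?sqr_ge0//.
by rewrite lerD2l ler_sqr ?nnegrE.
Qed.

Lemma esum_inv_weight_le (y : R) : 0 <= y ->
  (\esum_(k in [set: int]) (y / weight k)%:E <= (8 * y)%:E)%E.
Proof.
move=> y0.
have w0 k : (0 <= (y / weight k)%:E)%E.
  by rewrite lee_fin divr_ge0// ltW// weight_gt0.
have H (e : nat -> int) : injective e -> (forall n, n%:R <= `|(e n)%:~R| :> R) ->
    (\esum_(k in range e) (y / weight k)%:E <= (4 * y)%:E)%E.
  move=> ie en; rewrite esum_set_image//; last by move=> n m _ _ /ie.
  rewrite (eq_eseriesl (Q := xpredT)) => [|n]; last by rewrite in_setT.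
  exact: nneseries_inv_weight_le.
rewrite (esumID (range Posz))// setTI setTI.
(* The two halves of the integers are enumerated by [n] and [- n.+1]. *)
have -> : ~` range Posz = range Negz.
  apply/seteqP; split => [[n|n]/=|_ [n _ <-] [m _]//].
    by move=> h; exfalso; apply: h; exists n.
  by move=> _; exists n.
have -> : (8 * y)%:E = ((4 * y)%:E + (4 * y)%:E)%E by rewrite -EFinD; congr _%:E; ring.
apply: leeD; apply: H => //.
- by move=> n m [].
- by move=> n; rewrite normr_nat.
- by move=> n m [].
- by move=> n; rewrite NegzE mulrNz normrN normr_nat ler_nat.
Qed.

(** One more power of the weight in the pointwise bound makes the series
    converge, since the inverse weights are summable. *)
Lemma sobolev_norm_le p f (x : R) : 0 <= x ->
  (forall k, weight k ^+ p.+1 * nrm (fourier f k) <= x) ->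
  (sobolev_norm p f <= (3 * x)%:E)%E.
Proof.
move=> x0 fx; have w0 := @weight_gt0 R.
rewrite /sobolev_norm poweR12_sqrt ?sobolev_sqnorm_ge0//.
have x0E : (0 <= (3 * x)%:E)%E by rewrite lee_fin mulr_ge0.
rewrite -[(3 * x)%:E]gee0_abs// -sqrte_sqr lee_sqrt ?sqre_ge0//.
apply: (@le_trans _ _ (\esum_(k in [set: int]) (x ^+ 2 / weight k)%:E)).
  apply: le_esum => k _; rewrite lee_fin ler_pdivlMr//.
  apply: (@le_trans _ _ ((weight k ^+ p.+1 * nrm (fourier f k)) ^+ 2)).
    rewrite exprMn mulrAC ler_wpM2r ?sqr_ge0// -exprSr -exprM.
    by rewrite ler_weXn2l ?weight_ge1//; lia.
  by rewrite ler_sqr ?nnegrE// mulr_ge0 ?normc_ge0// ltW// exprn_gt0.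
apply: (le_trans (esum_inv_weight_le (sqr_ge0 x))).
(* The sum of the inverse weights is at most 8, and 8 <= 3 ^ 2. *)
by rewrite -EFin_expe lee_fin; have := sqr_ge0 x; nra.
Qed.

Lemma Hinfty_rapid f : Hinfty f -> rapid_symbol (fun _ => fourier f).
Proof.
move=> [Lf Sf]; split; last by near=> eps => k; exact: fourierN.
move=> s; have := Sf (s + s)%N.
have S0 := sobolev_sqnorm_ge0 (s + s) f; have := S0.
rewrite -ge0_fin_numE//; case E : (sobolev_sqnorm (s + s) f) => [x| |]// Sx _.
exists (Num.sqrt x); near=> eps => k; apply: sobolev_coefficient_le => //.
by rewrite /sobolev_norm poweR12_sqrt// E.
Unshelve. all: by end_near. Qed.

Lemma rapid_Hinfty f c : L2per f -> fourier f = c ->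
  rapid_symbol (fun _ : R => c) -> Hinfty f.
Proof.
move=> Lf fc [rc _]; split => // p; have [C /= rC] := rc p.+1.
have {}rC : forall k, weight k ^+ p.+1 * nrm (c k) <= C.
  by near (0 : R)^'+ => eps; near: eps.
have C0 : 0 <= C.
  by apply: le_trans (rC 0); rewrite mulr_ge0 ?normc_ge0// ltW// weightX_gt0.
rewrite -fc in rC; have := sobolev_norm_le C0 rC.
rewrite /sobolev_norm poweR12_sqrt ?sobolev_sqnorm_ge0//.
by case: sobolev_sqnorm => // x _; exact: ltry.
Unshelve. all: by end_near. Qed.

Lemma bigO_sobolev_rapid n (phi : R -> R -> R) r :
  (forall p, bigO_eps n (fun eps => sobolev_norm p (phi eps))) ->
  (\forall eps \near 0^'+, forall k,
     fourier (phi eps) k = (eps ^+ n)%:C * r eps k) -> rapid r.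
Proof.
move=> phiO phiE s; have [C HC] := phiO (s + s)%N.
exists `|C|; near=> eps => k.
have e0 : 0 < eps ^+ n by rewrite exprn_gt0//; near: eps; exact: nbhs_right_gt.
rewrite -(ler_pM2l e0).
have -> : eps ^+ n * (weight k ^+ s * nrm (r eps k)) =
    weight k ^+ s * nrm (fourier (phi eps) k).
  have -> : fourier (phi eps) k = (eps ^+ n)%:C * r eps k by move: (k); near: eps.
  by rewrite ComplexField.Normc.normcM normc_real gtr0_norm//; ring.
apply: sobolev_coefficient_le; first by rewrite mulr_ge0// ltW.
apply: (@le_trans _ _ (C * eps ^+ n)%:E); first by near: eps.
by rewrite lee_fin mulrC ler_wpM2l ?ler_norm// ltW.
Unshelve. all: by end_near. Qed.

Lemma rapid_bigO_sobolev n (phi : R -> R -> R) r : rapid r ->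
  (\forall eps \near 0^'+, forall k,
     fourier (phi eps) k = (eps ^+ n)%:C * r eps k) ->
  forall p, bigO_eps n (fun eps => sobolev_norm p (phi eps)).
Proof.
move=> rr phiE p; have [C HC] := rr p.+1; exists (3 * C); near=> eps.
have e0 : 0 < eps ^+ n by rewrite exprn_gt0//; near: eps; exact: nbhs_right_gt.
have rC k : weight k ^+ p.+1 * nrm (r eps k) <= C by move: k; near: eps.
have C0 : 0 <= C.
  by apply: le_trans (rC 0); rewrite mulr_ge0 ?normc_ge0// ltW// weightX_gt0.
rewrite -mulrA; apply: sobolev_norm_le => [|k]; first by rewrite mulr_ge0// ltW.
have -> : fourier (phi eps) k = (eps ^+ n)%:C * r eps k.
  by move: (k); near: eps.
rewrite ComplexField.Normc.normcM normc_real gtr0_norm// mulrCA mulrC.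
by rewrite ler_pM2r.
Unshelve. all: by end_near. Qed.

End Sobolev.

(** * Functions with prescribed Fourier coefficients *)

Section Reconstruction.
Context {R : realType}.
Local Notation mu := (@lebesgue_measure R).
Local Notation nrm := (@ComplexField.Normc.normc R).
Implicit Types f g h : R -> R.

Lemma continuous_wave k (z : R[i]) : continuous (wave k z).
Proof.
move=> x; have d := is_derive_wave k z x.
by apply: differentiable_continuous; apply/derivable1_diffP; exact: ex_derive.
Qed.

Lemma measurable_wave k (z : R[i]) : measurable_fun setT (wave k z).
Proof. by apply: continuous_measurable_fun; exact: continuous_wave. Qed.

Lemma normr_wave_le k (z : R[i]) x : `|wave k z x| <= 2 * nrm z.
Proof.
have re := normc_ge_normRe z.
have im : `|complex.Im z| <= nrm z.
  by case: (z) => a b /=; rewrite -sqrtr_sqr ler_wsqrtr// lerDr sqr_ge0.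
apply: (le_trans (ler_normD _ _)); rewrite !normrM mulr_natl mulr2n.
by apply: lerD; rewrite -[leRHS]mulr1 ler_pM ?normr_cos_le1 ?normr_sin_le1.
Qed.

Lemma L2per_wave k (z : R[i]) : L2per (wave k z).
Proof.
apply: (@bounded_L2per _ _ (2 * nrm z)).
- exact: periodic_wave.
- exact: measurable_wave.
- by move=> x; exact: normr_wave_le.
Qed.

(** A wave with [k != 0] is the derivative of a periodic wave, so its integral
    over a period vanishes. *)
Lemma Rintegral_wave k (z : R[i]) :
  \int[mu]_(x in Omega) wave k z x = (k == 0)%:R * (pi *+ 2 * complex.Re z).
Proof.
have [->|k0] := eqVneq k 0.
  under eq_Rintegral do rewrite /wave mul0r cos0 sin0 mulr1 mulr0 addr0.
  rewrite (Rintegral_cst _ (measurable_Omega (R := R))) mul1r [RHS]mulrC.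
  by congr (_ * _); exact: (congr1 fine (measure_Omega (R := R))).
have ik0 : - ik k != 0 :> R[i].
  by rewrite oppr_eq0 /ik eq_complex/= intr_eq0 (negbTE k0) andbF.
pose F := wave k (z / - ik k).
have dF (x : R) : is_derive x (1 : R) F (wave k z x).
  by have := is_derive_wave k (z / - ik k) x; rewrite [- ik k * _]mulrC divfK.
have cF : continuous F by exact: continuous_wave.
rewrite mul0r /Rintegral (@continuous_FTC2 _ _ F).
- have -> : F pi = F (- pi).
    by rewrite /F -(periodic_wave k (z / - ik k) (- pi)) mulr2n addKr.
  by rewrite -EFinB subrr.
- by rewrite gtrN ?pi_gt0.
- by apply: continuous_subspaceT; exact: continuous_wave.
- split.
  + by move=> x _; have := dF x => ?; exact: ex_derive.
  + by apply: cvg_at_right_filter; exact: cF.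
  + by apply: cvg_at_left_filter; exact: cF.
- by move=> x _; rewrite derive1E; have := dF x => ?; exact: derive_val.
Qed.

Lemma waveM n k (z w : R[i]) x : wave n z x * wave k w x =
  2^-1 * (wave (n + k) (z * w) x + wave (n - k) (z * w^*%C) x).
Proof.
rewrite /wave.
have -> : (n + k)%:~R * x = n%:~R * x + k%:~R * x by rewrite rmorphD mulrDl.
have -> : (n - k)%:~R * x = n%:~R * x - k%:~R * x by rewrite rmorphB mulrBl.
rewrite cosD cosB sinD sinB.
by case: z w => a b [c d]; simpc; rewrite /=; field.
Qed.

Lemma integrable_wave k (z : R[i]) : mu.-integrable Omega (EFin \o wave k z).
Proof.
have mcst : measurable_fun [set: R] (fun=> 1 : R) by exact: measurable_cst.
have := L2per_integrableM (M := 1) (L2per_wave k z) mcst.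
rewrite (_ : (fun x => wave k z x * 1) = wave k z); last first.
  by apply/funext => x; rewrite mulr1.
by apply => _; rewrite normr1.
Qed.

(** The orthogonality relations. A real wave with wave number [n] excites both
    [n] and [- n], which is why two terms appear; they coincide for
    [n = 0]. *)
Lemma fourier_wave n (z : R[i]) k : fourier (wave n z) k =
  2^-1%:C * ((n + k == 0)%:R * z + (n - k == 0)%:R * z^*%C).
Proof.
have p0 : pi *+ 2 != 0 :> R by rewrite gt_eqF// pmulrn_lgt0// pi_gt0.
apply: complex_eq_Re => w; apply: (mulfI p0).
have -> : pi *+ 2 * complex.Re (w * fourier (wave n z) k) =
    complex.Re (w * ((pi *+ 2)%:C * fourier (wave n z) k)).
  by case: (w) => a b; case: (fourier _ _) => c d; simpc; rewrite /=; ring.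
rewrite -Rintegral_mul_wave; last exact: L2per_wave.
under eq_Rintegral do rewrite waveM.
rewrite RintegralZl; first last.
- rewrite (_ : _ \o _ = (fun x => (EFin \o wave (n + k) (z * w)%R) x +
                                (EFin \o wave (n - k) (z * w^*%C)%R) x)%E).
    by apply: integrableD; [exact: measurable_Omega|exact: integrable_wave..].
  by apply/funext => x.
- exact: measurable_Omega.
rewrite RintegralD; [|exact: measurable_Omega|exact: integrable_wave..].
rewrite !Rintegral_wave -!(rmorph_nat (real_complex R)).
move: (_ == _) (_ == _) => b1 b2; case: z w => a b [c d].
move: (b1%:R) (b2%:R) => x y.
by simpc; rewrite /=; field.
Qed.

(** Dominated convergence with a constant bound. *)
Lemma Rintegral_bounded_cvg (F : nat -> R -> R) f h (M : R) :
  (forall N, measurable_fun setT (F N)) -> (forall N x, `|F N x| <= M) ->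
  (forall x, F N x @[N --> \oo] --> f x) -> measurable_fun setT h ->
  (forall x, `|h x| <= 1) ->
  \int[mu]_(x in Omega) (F N x * h x) @[N --> \oo] -->
  \int[mu]_(x in Omega) (f x * h x).
Proof.
move=> mF FM Ff mh h1.
have mf : measurable_fun setT f.
  by apply: (measurable_fun_cvg mF) => x _; exact: Ff.
have mFh (g : R -> R) : measurable_fun setT g ->
    measurable_fun Omega (fun x => (g x * h x)%:E).
  move=> mg; apply/measurable_EFinP/(measurable_funS measurableT (@subsetT _ _)).
  exact: measurable_funM.
have cv : {ae mu, forall x, Omega x ->
    (F N x * h x)%:E @[N --> \oo] --> (f x * h x)%:E}.
  apply/aeW => x _; apply/fine_cvgP; split; first by near=> N.
  by apply: cvgMl; exact: Ff.
have bd : {ae mu, forall x N, Omega x ->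
    (`|(F N x * h x)%:E| <= (EFin \o cst M) x)%E}.
  apply/aeW => x N _; rewrite lee_fin normrM -[leRHS]mulr1.
  exact: ler_pM.
have [if_ _ cvF] := dominated_convergence (measurable_Omega (R := R))
  (fun N => mFh _ (mF N)) (mFh _ mf) cv (integrable_Omega_cst M) bd.
have ifin := integrable_fin_num (measurable_Omega (R := R)) if_.
by apply: fine_cvg; rewrite /Rintegral fineK.
Unshelve. all: by end_near. Qed.

Lemma L2per_lincomb N f (a : nat -> R) (g : nat -> R -> R) : L2per f ->
  (forall j, L2per (g j)) -> L2per (fun x => f x + \sum_(j < N) a j * g j x).
Proof.
move=> Lf Lg; elim: N => [|N IH].
  rewrite (_ : (fun x => _) = f)//; apply/funext => x.
  by rewrite big_ord0 addr0.
rewrite (_ : (fun x => _) = fun x =>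
  (f x + \sum_(j < N) a j * g j x) + a N * g N x); first exact: L2per_affine.
by apply/funext => x; rewrite big_ord_recr addrA.
Qed.

Lemma fourier_lincomb N f (a : nat -> R) (g : nat -> R -> R) k : L2per f ->
  (forall j, L2per (g j)) -> fourier (fun x => f x + \sum_(j < N) a j * g j x) k =
  fourier f k + \sum_(j < N) (a j)%:C * fourier (g j) k.
Proof.
move=> Lf Lg; elim: N => [|N IH].
  rewrite (_ : (fun x => _) = f) ?big_ord0 ?addr0//; apply/funext => x.
  by rewrite big_ord0 addr0.
rewrite (_ : (fun x => _) = fun x =>
  (f x + \sum_(j < N) a j * g j x) + a N * g N x).
  rewrite fourier_affine//; last exact: L2per_lincomb.
  by rewrite IH [in RHS]big_ord_recr/= addrA.
by apply/funext => x; rewrite big_ord_recr addrA.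
Qed.

Section Series.
Variable c : int -> R[i].
Hypothesis c_rapid : rapid_symbol (fun _ : R => c).

(** Summing real waves over the natural numbers instead of exponentials over
    the integers, each wave number [n > 0] stands for the pair [n], [- n],
    hence the factor 2. *)
Let z (n : nat) : R[i] := (if n == 0%N then 1 else 2)%:C * (c n)^*%C.
Let F (N : nat) (x : R) := \sum_(j < N) wave j (z j) x.

Let cN k : c (- k) = (c k)^*%C.
Proof.
have [_ hc] := c_rapid; near (0 : R)^'+ => eps.
by move: (k); near: eps.
Unshelve. all: by end_near. Qed.

Let c_decay : exists2 C, 0 <= C & forall k, nrm (c k) <= C / weight k.
Proof.
have [/(_ 1%N)[C rC] _] := c_rapid.
have {}rC k : weight k ^+ 1 * nrm (c k) <= C.
  by near (0 : R)^'+ => eps; move: (k); near: eps.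
exists C; last by move=> k; rewrite ler_pdivlMr ?weight_gt0// mulrC -(expr1 (weight k)).
by apply: le_trans (rC 0); rewrite mulr_ge0 ?normc_ge0// ltW// weightX_gt0.
Unshelve. all: by end_near. Qed.

Let wave_decay : exists2 C, 0 <= C & forall (n : nat) x,
  `|wave n (z n) x| <= C / weight n.
Proof.
have [C C0 cC] := c_decay; exists (4 * C); first by rewrite mulr_ge0.
move=> n x; apply: (le_trans (normr_wave_le _ _ _)).
rewrite /z ComplexField.Normc.normcM normc_real normc_conj.
have : `|if n == 0%N then 1 else 2 : R| <= 2.
  by case: ifP; rewrite ger0_norm//; lra.
have := cC n; rewrite -mulrA; move: (C / _) => D.
have := normc_ge0 (c n); move: (nrm _) (`|_|) => r s; nra.
Qed.

Let F_bounded : exists M, forall N x, `|F N x| <= M.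
Proof.
have [C C0 wC] := wave_decay; exists (C * 4) => N x.
apply: (le_trans (ler_norm_sum _ _ _)).
apply: (@le_trans _ _ (C * \sum_(0 <= n < N) (1 + (n%:R : R) ^+ 2)^-1)); last first.
  by rewrite ler_wpM2l// sum_inv_sqr_le.
rewrite big_mkord mulr_sumr; apply: ler_sum => n _; apply: (le_trans (wC n x)).
by rewrite /weight ger0_norm// ler0n.
Qed.

Let F_cvg x : cvgn (fun N => F N x).
Proof.
have [C C0 wC] := wave_decay.
have FE : (fun N => F N x) = series (fun n => wave n (z n) x).
  by apply/funext => N; rewrite /F /series /= big_mkord.
rewrite FE; apply: normed_cvg.
have v0 (n : nat) : 0 <= C / weight n by rewrite divr_ge0// ltW// weight_gt0.
apply: (@series_le_cvg _ _ (fun n => C / weight n)) => //.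
- by move=> n /=.
- by move=> n; exact: wC.
apply: nnseries_is_cvg => //.
apply: (le_lt_trans (nneseries_inv_weight_le (e := Posz) C0 _)); last exact: ltry.
by move=> n; rewrite normr_nat.
Qed.

Let F_measurable N : measurable_fun setT (F N).
Proof. by apply: measurable_sum => n; exact: measurable_wave. Qed.

Let F_L2per N : L2per (F N).
Proof.
rewrite (_ : F N = fun x => 0 + \sum_(j < N) 1 * wave j (z j) x).
  exact: (L2per_lincomb N (fun=> 1) (L2per_cst 0)
    (fun j => L2per_wave j (z j))).
by apply/funext => x; rewrite add0r; under [RHS]eq_bigr do rewrite mul1r.
Qed.

Let fourier_F N k : (`|k| < N)%N -> fourier (F N) k = c k.
Proof.
move=> kN; rewrite (_ : F N = fun x => 0 + \sum_(j < N) 1 * wave j (z j) x); last first.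
  by apply/funext => x; rewrite add0r; under [RHS]eq_bigr do rewrite mul1r.
rewrite (fourier_lincomb N (fun=> 1) k (L2per_cst 0)
  (fun j => L2per_wave j (z j))).
rewrite fourier0 add0r (bigD1 (Ordinal kN))//= big1 ?addr0 => [|j jk].
  rewrite rmorph1 mul1r fourier_wave /z.
  have r2 : 2%:C = 2%:R :> R[i] by rewrite rmorph_nat.
  have r2V : 2^-1%:C = 2%:R^-1 :> R[i] by rewrite fmorphV rmorph_nat.
  have zC w : (2%:C * w^*%C)^*%C = 2%:C * w :> R[i].
    case: w => a b; apply/eqP; rewrite eq_complex /=.
    by apply/andP; split; apply/eqP; ring.
  case: k kN => [[|n]|n] _ /=.
  - have c0 : (c 0)^*%C = c 0 by rewrite -cN oppr0.
    by rewrite c0 rmorph1 !mul1r c0 r2V; field.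
  - by rewrite subrr eqxx mulr1n mul0r add0r mul1r zC r2 r2V;
      field.
  - by rewrite NegzE subrr eqxx mulr1n cN mul0r addr0 mul1r r2 r2V; field.
rewrite rmorph1 mul1r fourier_wave.
have /negbTE jk' : (j : nat) != `|k|%N by [].
have -> : (Posz j + k == 0) = false by apply/negP => /eqP; lia.
have -> : (Posz j - k == 0) = false by apply/negP => /eqP; lia.
by rewrite !mul0r addr0 mulr0.
Qed.

(** The Fourier series converges absolutely and uniformly, so its sum is a
    bounded measurable periodic function. By dominated convergence its Fourier
    coefficients are the limits of those of the partial sums, which are
    eventually equal to the prescribed ones. *)
Lemma fourier_reconstruction : exists2 f, Hinfty f & fourier f = c.
Proof.
have [M FM] := F_bounded; pose f x := limn (fun N => F N x).
have mf : measurable_fun setT f.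
  by apply: (measurable_fun_cvg F_measurable) => x _; exact: F_cvg.
have Lf : L2per f.
  apply: (@bounded_L2per _ _ M) => // [x|x].
    congr (limn _); apply/funext => N; apply: eq_bigr => j _.
    exact: periodic_wave.
  rewrite ler_norml; apply/andP; split.
    apply: limr_ge; first exact: F_cvg.
    by apply: nearW => N; have := FM N x; rewrite ler_norml => /andP[].
  apply: limr_le; first exact: F_cvg.
  by apply: nearW => N; have := FM N x; rewrite ler_norml => /andP[].
suff fc : fourier f = c by exists f => //; exact: rapid_Hinfty fc c_rapid.
have E (h : R -> R) (G : R) : measurable_fun setT h -> (forall x, `|h x| <= 1) ->
    (\forall N \near \oo, \int[mu]_(x in Omega) (F N x * h x) = G) ->
    \int[mu]_(x in Omega) (f x * h x) = G.
  move=> mh h1 FG; have cvF := Rintegral_bounded_cvg F_measurable FM F_cvg mh h1.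
  by apply: (cvg_unique _ cvF) => //; exact: cvg_near_cst.
have p0 : pi *+ 2 != 0 :> R by rewrite gt_eqF// pmulrn_lgt0// pi_gt0.
apply/funext => k; case ck : (c k) => [a b].
have Fk : \forall N \near \oo, fourier (F N) k = Complex a b.
  by exists `|k|.+1%N => // N /= kN; rewrite -ck; exact: fourier_F.
congr Complex.
  rewrite (E _ (pi *+ 2 * a)); first by rewrite mulKf.
  - exact: measurable_cosM.
  - by move=> x; exact: normr_cos_le1.
  - by apply: filterS Fk => N [<- _]; rewrite mulVKf.
rewrite (E _ (pi *+ 2 * - b)); first by rewrite mulKf// opprK.
- exact: measurable_sinM.
- by move=> x; exact: normr_sin_le1.
- by apply: filterS Fk => N [_ <-]; rewrite opprK mulVKf.
Qed.

End Series.
End Reconstruction.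

(** * From Fourier coefficients back to functions *)

Section Transfer.
Context {R : realType}.
Implicit Types (phi : R -> R -> R).

Lemma fourier_remainder phi (g : nat -> R -> R) (N : nat) (eps : R) k : eps != 0 ->
  L2per (phi eps) -> (forall j, L2per (g j)) ->
  fourier (fun x => phi eps x - \sum_(j < N) eps ^+ j * g j x) k =
  (eps ^+ N)%:C *
    remainder (fun e => fourier (phi e)) (fun j => fourier (g j)) N eps k.
Proof.
move=> e0 Lphi Lg; rewrite /remainder mulrC divfK; last first.
  by rewrite fmorph_eq0 expf_neq0.
rewrite (_ : (fun x => _) =
  fun x => phi eps x + \sum_(j < N) - eps ^+ j * g j x); last first.
  by apply/funext => x; rewrite -sumrN; under [in RHS]eq_bigr do rewrite mulNr.
rewrite (fourier_lincomb N (fun j => - eps ^+ j) k Lphi Lg) -sumrN.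
by congr (_ + _); apply: eq_bigr => j _; rewrite rmorphN mulNr.
Qed.

Lemma conj_symmetric_remainder (a : R -> int -> R[i]) (c : nat -> int -> R[i]) N :
  conj_symmetric a -> (forall j k, c j (- k) = (c j k)^*%C) ->
  conj_symmetric (remainder a c N).
Proof.
move=> ha hc; near=> eps => k; rewrite /remainder.
have -> : a eps (- k) = (a eps k)^*%C by move: k; near: eps.
have conjM (x y : R[i]) : (x * y)^*%C = x^*%C * y^*%C by exact: rmorphM.
have conjB (x y : R[i]) : (x - y)^*%C = x^*%C - y^*%C by exact: rmorphB.
rewrite conjM conjc_inv conjc_real conjB; congr ((_ - _) / _).
rewrite (big_morph (@conjc R) (rmorphD _) (rmorph0 _)).
by apply: eq_bigr => j _; rewrite hc conjM conjc_real.
Unshelve. all: by end_near. Qed.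

(** Each coefficient is a combination of two consecutive remainders. *)
Lemma expandable_coefficient K (a : R -> int -> R[i]) (c : nat -> int -> R[i]) :
  symbol_module K -> (forall N, K (remainder a c N)) ->
  forall j, K (fun _ => c j).
Proof.
move=> HK Ka j.
apply: (sm_ext HK) (sm_add HK (Ka j) (sm_mul HK (symbol_eps (-1)) (Ka j.+1))).
near=> eps => k; rewrite /remainder big_ord_recr/= mulN1r rmorphN/= exprS.
have e0 : eps%:C != 0 :> R[i] by rewrite fmorph_eq0; near: eps; exact: near_neq0.
rewrite !rmorphM/= !rmorphXn/=; field.
by rewrite e0 expf_neq0.
Unshelve. all: by end_near. Qed.

(** The Sobolev bounds on the remainders are bounds on their Fourier
    coefficients. *)
Lemma hilbert_expansion_expandable phi :
  (\forall eps \near 0^'+, L2per (phi eps)) -> has_hilbert_expansion phi ->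
  expandable rapid_symbol (fun eps => fourier (phi eps)).
Proof.
move=> Lphi [g [Hg phig]].
have Lg j : L2per (g j) by have [] := Hg j.
apply: (expandableI (c := fun j => fourier (g j))) => [||N].
- exact: symbol_moduleR.
- exact: Hinfty_rapid.
split.
  apply: (bigO_sobolev_rapid (phig N)); near=> eps => k.
  by rewrite fourier_remainder//; near: eps => //; exact: near_neq0.
apply: conj_symmetric_remainder; last by move=> j k; exact: fourierN.
by near=> eps => k; apply: fourierN; near: eps.
Unshelve. all: by end_near. Qed.

(** The coefficients of the expansion on the Fourier side decay rapidly, as
    differences of remainders do, hence are the Fourier coefficients of
    functions. *)
Lemma expandable_hilbert_expansion phi :
  (\forall eps \near 0^'+, L2per (phi eps)) ->
  expandable rapid_symbol (fun eps => fourier (phi eps)) ->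
  has_hilbert_expansion phi.
Proof.
move=> Lphi [c Kc]; have Kcj := expandable_coefficient symbol_moduleR Kc.
have /choice[g Hg] : forall j, exists g, Hinfty g /\ fourier g = c j.
  by move=> j; have [g] := fourier_reconstruction (Kcj j); exists g.
have Lg j : L2per (g j) by have [[]] := Hg j.
exists g; split=> [j|N]; first by have [] := Hg j.
have [rc _] := Kc N.+1; apply: (rapid_bigO_sobolev rc); near=> eps => k.
have e0 : eps != 0 by near: eps; exact: near_neq0.
rewrite fourier_remainder//; last by near: eps.
by rewrite (_ : (fun j => fourier (g j)) = c)//; apply/funext => j; have [] := Hg j.
Unshelve. all: by end_near. Qed.

Lemma fourier1 k : fourier (fun _ : R => 1) k = (k == 0)%:R.
Proof.
have -> : (fun _ : R => 1) = wave 0 1.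
  by apply/funext => x; rewrite /wave/= mul0r cos0 sin0 mulr1 mulr0 addr0.
rewrite fourier_wave add0r sub0r oppr_eq0 mulr1 conjc1 mulr1 fmorphV rmorph_nat.
by field.
Qed.

(** The constant is the mean value, which is real; subtracting it removes the
    mode [k = 0] and leaves the others unchanged. *)
Lemma oscillation_constant_up_to n phi (b : R -> int -> R[i]) :
  (\forall eps \near 0^'+, L2per (phi eps)) -> rapid_symbol b ->
  (\forall eps \near 0^'+, forall k, k != 0 ->
     fourier (phi eps) k = (eps ^+ n)%:C * b eps k) ->
  constant_up_to n phi.
Proof.
move=> Lphi Kb phib; exists (fun eps => complex.Re (fourier (phi eps) 0)).
have sk : symbol (fun (_ : R) k => (k != 0)%:R).
  by apply: (symbol_indicator (P := predC1 0)) => k; rewrite /= oppr_eq0.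
have [rb _] := sm_mul symbol_moduleR sk Kb.
apply: (rapid_bigO_sobolev rb); near=> eps => k.
have Le : L2per (phi eps) by near: eps.
set x0 := complex.Re _.
rewrite (_ : (fun x => _) = fun x => phi eps x + - x0 * 1); last first.
  by apply/funext => x; rewrite mulr1.
rewrite (fourier_affine _ _ Le (L2per_cst 1)) fourier1.
have [->|k0] := eqVneq k 0; last first.
  rewrite mulr0 addr0 mul1r; move: (k) k0; near: eps.
  exact: phib.
rewrite mulr1 mul0r mulr0 /x0.
have := fourierN 0 Le; rewrite oppr0; case: (fourier _ _) => u v [vN].
have -> : v = 0 by lra.
by apply/eqP; rewrite eq_complex/= subrr addr0 eqxx.
Unshelve. all: by end_near. Qed.

End Transfer.

Theorem theorem4p11 (R : realType) (gamma dt eps0 : R)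
    (rhoR uR ER pR : R -> R) (rhoR_ mR_ ER_ pR_ : nat -> R)
    (pLstar pL : R -> R -> R)
    (gamma_gt1 : 1 < gamma) (dt_gt0 : 0 < dt) (eps0_gt0 : 0 < eps0)
    (rhoR_gt0 : forall eps : R, 0 < eps <= eps0 -> 0 < rhoR eps)
    (pR_gt0 : forall eps : R, 0 < eps <= eps0 -> 0 < pR eps)
    (eos : forall eps : R, 0 < eps <= eps0 ->
       ER eps = pR eps / (gamma - 1) + eps ^+ 2 / 2 * rhoR eps * uR eps ^+ 2)
    (rhoR_exp : scalar_expansion rhoR rhoR_)
    (mR_exp : scalar_expansion (fun eps => rhoR eps * uR eps) mR_)
    (ER_exp : scalar_expansion ER ER_)
    (pR_exp : scalar_expansion pR pR_)
    (rhoR0_gt0 : 0 < rhoR_ 0%N) (pR0_gt0 : 0 < pR_ 0%N)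
    (pLstar_Hinfty : forall eps : R, 0 < eps <= eps0 -> Hinfty (pLstar eps))
    (pLstar_exp : has_hilbert_expansion pLstar)
    (pL_Hinfty : forall eps : R, 0 < eps <= eps0 -> Hinfty (pL eps))
    (pL_eq : forall eps : R, 0 < eps <= eps0 ->
       periodic_ode3 (omega0 gamma) (omega1 gamma dt (uR eps))
         (omega2 gamma dt (rhoR eps) (ER eps) (pR eps) / eps ^+ 2)
         (omega3 gamma dt (rhoR eps) (uR eps) (ER eps) (pR eps) / eps ^+ 2)
         (pL eps) (pLstar eps)) :
  has_hilbert_expansion pL /\ constant_up_to 2 pL.
Proof.
have small : \forall eps \near 0^'+, 0 < eps <= eps0.
  near=> eps; apply/andP; split; near: eps; first exact: nbhs_right_gt.
  exact: nbhs_right_le.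
have LpLstar : \forall eps \near 0^'+, L2per (pLstar eps).
  by apply: filterS small => eps /pLstar_Hinfty[].
have LpL : \forall eps \near 0^'+, L2per (pL eps).
  by apply: filterS small => eps /pL_Hinfty[].
have w0_lt0 : omega0 gamma < 0.
  by rewrite /omega0 mulN1r oppr_lt0 invr_gt0 subr_gt0.
have [C C0 w2C] := omega2_bounded_below gamma_gt1 dt_gt0 eps0_gt0 eos
  rhoR_exp mR_exp pR_exp rhoR0_gt0 pR0_gt0.
have w1E := omega1_expandable gamma dt rhoR_exp mR_exp rhoR0_gt0.
have w2E := omega2_expandable gamma dt rhoR_exp ER_exp pR_exp rhoR0_gt0.
have w3E := omega3_expandable gamma dt rhoR_exp mR_exp ER_exp pR_exp rhoR0_gt0.
have AE := hilbert_expansion_expandable LpLstar pLstar_exp.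
have BE : near_eq (fun eps => fourier (pLstar eps)) (fun eps k =>
    ode_symbol (omega0 gamma) (omega1 gamma dt (uR eps))
      (omega2 gamma dt (rhoR eps) (ER eps) (pR eps) / eps ^+ 2)
      (omega3 gamma dt (rhoR eps) (uR eps) (ER eps) (pR eps) / eps ^+ 2) k *
    fourier (pL eps) k).
  apply: filterS small => eps e k; have [LL _] := pL_Hinfty eps e.
  have [[_ mL _] _] := pLstar_Hinfty eps e.
  exact: fourier_ode (pL_eq eps e).
split.
  apply: expandable_hilbert_expansion => //.
  exact: dispersion_solution_expandable w0_lt0 C0 w2C w1E w2E w3E AE BE.
have [b Kb bE] :=
  dispersion_solution_oscillation w0_lt0 C0 w2C w1E w2E w3E AE BE.
exact: oscillation_constant_up_to Kb bE.
Unshelve. all: by end_near. Qed.
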